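(* Let $\Omega\subset B(\mathcal H)^d$ and let $f:\Omega\to B(\mathcal H)^r$ be a strong NC function. If $Df(x):B(\mathcal H)^d\to B(\mathcal H)^r$ is injective for every $x\in\Omega$, then $Df(x)$ is bounded below for every $x\in\Omega$.
   Context: Throughout, $\mathcal H$ is an infinite-dimensional separable complex Hilbert space, $B(\mathcal H)$ the bounded operators with the operator norm, and $\mathcal H^{(l)}$ ($l\in\mathbb N\cup\{\infty\}$) the direct sum of $l$ copies of $\mathcal H$. $B(\mathcal H)^d$ has the norm $\|x\|=\max_i\|x^i\|$. Operations on tuples are componentwise: for bounded invertible linear $s:\mathcal H\to\mathcal H^{(l)}$ and $z\in B(\mathcal H^{(l)})^d$, $s^{-1}zs=(s^{-1}z^1s,\dots,s^{-1}z^ds)$; for a finite or countable uniformly bounded sequence $x_1,x_2,\dots$ in $B(\mathcal H)^d$ of length $l$, $\bigoplus_n x_n\in B(\mathcal H^{(l)})^d$ has $i$-th entry $\bigoplus_n x_n^i$; block matrices of tuples are defined entrywise per coordinate. A set is unitarily invariant if $u^*xu$ lies in it for each of its elements $x$ and each unitary $u\in B(\mathcal H)$. The strong operator topology (SOT) on $B(\mathcal H)^d$ is the product of the SOT on each coordinate. NC domain: $\Omega\subset B(\mathcal H)^d$ is an NC domain if there are subsets $\Omega_1,\Omega_2,\dots$ of $\Omega$ with (1) $\Omega_k\subset\mathrm{int}\,\Omega_{k+1}$ (norm interior) and $\Omega=\bigcup_k\Omega_k$; (2) each $\Omega_k$ norm-bounded and unitarily invariant; (3) for every sequence $x_1,x_2,\dots$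 in $\Omega_k$ of length $l\in\mathbb N\cup\{\infty\}$ there is a unitary $u:\mathcal H\to\mathcal H^{(l)}$ with $u^{-1}(\bigoplus_n x_n)u\in\Omega_k$. NC function: $f:\Omega\to B(\mathcal H)^r$ on an NC domain is NC if whenever $x,y\in\Omega$ and $s:\mathcal H\to\mathcal H^{(2)}$ is bounded, linear, invertible with $s^{-1}\begin{bmatrix}x&0\\0&y\end{bmatrix}s\in\Omega$, then $f\Big(s^{-1}\begin{bmatrix}x&0\\0&y\end{bmatrix}s\Big)=s^{-1}\begin{bmatrix}f(x)&0\\0&f(y)\end{bmatrix}s$. Every NC function is Fréchet differentiable; $Df(x)$ denotes its Fréchet derivative at $x$. Strong NC domain: $\Omega$ is a strong NC domain if it has an exhausting sequence $\{\Omega_k\}$ as in the definition of NC domain such that, additionally, (i) each $\Omega_k$ is closed in the strong operator topology, and (ii) for each $k$ there is $\varepsilon_k>0$ such that $\Omega_{k+1}$ contains $\{x\in B(\mathcal H)^d:\mathrm{dist}(x,\Omega_k)<\varepsilon_k\}$. Strong NC function: $f:\Omega\to B(\mathcal H)^r$ is a strong NC function if $f$ is an NC function and there is an exhausting sequence $\{\Omega_k\}$ of $\Omega$ as in the definition of strong NC domain such that each restriction $f|_{\Omega_k}$ is continuous for the strong operator topology. An operator $T$ is bounded below if $\|Tv\|\ge C\|v\|$ for some $C>0$ and all $v$. *)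

(* Defs.v *)
From Stdlib Require Import Reals Lra Classical ClassicalEpsilon List.
From Stdlib Require Vectors.Fin.
Open Scope R_scope.

Record Cx := mkCx { Cre : R; Cim : R }.
Definition C0 : Cx := mkCx 0 0.
Definition C1 : Cx := mkCx 1 0.
Definition Cadd (a b : Cx) : Cx := mkCx (Cre a + Cre b) (Cim a + Cim b).
Definition Cmul (a b : Cx) : Cx :=
  mkCx (Cre a * Cre b - Cim a * Cim b) (Cre a * Cim b + Cim a * Cre b).
Definition Cconj (a : Cx) : Cx := mkCx (Cre a) (- Cim a).

Lemma Rsup_ex (E : R -> Prop) :
  exists m, is_lub E m \/ (~ (exists m', is_lub E m') /\ m = 0).
Proof.
  destruct (classic (exists m', is_lub E m')) as [[m Hm]|Hn].
  - exists m; left; exact Hm.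
  - exists 0; right; split; [exact Hn | reflexivity].
Qed.
Definition Rsup (E : R -> Prop) : R :=
  proj1_sig (constructive_indefinite_description _ (Rsup_ex E)).

Record HilbertSpace := {
  hs_car :> Type;
  hs_zero : hs_car;
  hs_add : hs_car -> hs_car -> hs_car;
  hs_opp : hs_car -> hs_car;
  hs_scal : Cx -> hs_car -> hs_car;
  hs_inner : hs_car -> hs_car -> Cx;
  hs_add_assoc : forall u v w, hs_add u (hs_add v w) = hs_add (hs_add u v) w;
  hs_add_comm : forall u v, hs_add u v = hs_add v u;
  hs_add_zero : forall v, hs_add v hs_zero = v;
  hs_add_opp : forall v, hs_add v (hs_opp v) = hs_zero;
  hs_scal_one : forall v, hs_scal C1 v = v;
  hs_scal_assoc : forall a b v, hs_scal a (hs_scal b v) = hs_scal (Cmul a b) v;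
  hs_scal_addl : forall a b v, hs_scal (Cadd a b) v = hs_add (hs_scal a v) (hs_scal b v);
  hs_scal_addr : forall a u v, hs_scal a (hs_add u v) = hs_add (hs_scal a u) (hs_scal a v);
  hs_inner_addl : forall u v w, hs_inner (hs_add u v) w = Cadd (hs_inner u w) (hs_inner v w);
  hs_inner_scall : forall a u w, hs_inner (hs_scal a u) w = Cmul a (hs_inner u w);
  hs_inner_conj : forall u v, hs_inner u v = Cconj (hs_inner v u);
  hs_inner_pos : forall v, v <> hs_zero -> 0 < Cre (hs_inner v v);
  hs_complete :
    let nrm := fun v => sqrt (Cre (hs_inner v v)) in
    forall s : nat -> hs_car,
      (forall eps, 0 < eps -> exists N, forall m n, (N <= m)%nat -> (N <= n)%nat ->
          nrm (hs_add (s m) (hs_opp (s n))) < eps) ->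
      exists lim, forall eps, 0 < eps -> exists N, forall n, (N <= n)%nat ->
          nrm (hs_add (s n) (hs_opp lim)) < eps
}.

Section Ops.
Context {H : HilbertSpace}.

Definition vsub (u v : H) : H := hs_add H u (hs_opp H v).
Definition hnorm (v : H) : R := sqrt (Cre (hs_inner H v v)).

Definition separable : Prop :=
  exists e : nat -> H, forall v eps, 0 < eps -> exists n, hnorm (vsub v (e n)) < eps.

Fixpoint lincomb (cs : list Cx) (vs : list H) : H :=
  match cs, vs with
  | c :: cs', v :: vs' => hs_add H (hs_scal H c v) (lincomb cs' vs')
  | _, _ => hs_zero H
  end.
Definition infinite_dimensional : Prop :=
  forall vs : list H, exists v, forall cs, v <> lincomb cs vs.

Definition is_linear (T : H -> H) : Prop :=
  (forall u v, T (hs_add H u v) = hs_add H (T u) (T v)) /\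
  (forall a v, T (hs_scal H a v) = hs_scal H a (T v)).
Definition is_BH (T : H -> H) : Prop :=
  is_linear T /\ exists M, forall v, hnorm (T v) <= M * hnorm v.
Definition opnorm (T : H -> H) : R :=
  Rsup (fun a => exists v, hnorm v <= 1 /\ a = hnorm (T v)).

Definition tuple (d : nat) := Fin.t d -> H -> H.
Definition is_BHd {d} (x : tuple d) : Prop := forall i, is_BH (x i).
Definition tnorm {d} (x : tuple d) : R := Rsup (fun a => exists i, a = opnorm (x i)).
Definition tadd {d} (x y : tuple d) : tuple d := fun i v => hs_add H (x i v) (y i v).
Definition tsub {d} (x y : tuple d) : tuple d := fun i v => vsub (x i v) (y i v).
Definition tscal {d} (a : Cx) (x : tuple d) : tuple d := fun i v => hs_scal H a (x i v).
Definition tzero {d} : tuple d := fun _ _ => hs_zero H.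

(* unitary operators on H and unitary invariance: y = u^* x u  <->  u y = x u *)
Definition unitary (u : H -> H) : Prop :=
  is_linear u /\ (forall w, exists v, u v = w) /\ (forall v, hnorm (u v) = hnorm v).
Definition unitarily_invariant {d} (A : tuple d -> Prop) : Prop :=
  forall x u y, A x -> unitary u -> (forall i v, u (y i v) = x i (u v)) -> A y.

(* ---------- direct sums H^(l), l in N u {oo} (None = oo) ---------- *)
Definition inrng (l : option nat) (n : nat) : bool :=
  match l with Some m => Nat.ltb n m | None => true end.
Definition valid_len (l : option nat) : Prop :=
  match l with Some m => (1 <= m)%nat | None => True end.
Definition psum (w : nat -> H) (N : nat) : R := sum_f_R0 (fun n => hnorm (w n) ^ 2) N.
Definition in_DS (l : option nat) (w : nat -> H) : Prop :=
  (forall n, inrng l n = false -> w n = hs_zero H) /\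
  (exists M, forall N, psum w N <= M).
Definition dsnorm (w : nat -> H) : R := sqrt (Rsup (fun a => exists N, a = psum w N)).
Definition ds_linear (s : H -> nat -> H) : Prop :=
  (forall u v, s (hs_add H u v) = fun n => hs_add H (s u n) (s v n)) /\
  (forall a v, s (hs_scal H a v) = fun n => hs_scal H a (s v n)).
Definition bounded_invertible (l : option nat) (s : H -> nat -> H) : Prop :=
  ds_linear s /\ (forall v, in_DS l (s v)) /\
  (exists M, forall v, dsnorm (s v) <= M * hnorm v) /\
  (forall w, in_DS l w -> exists v, s v = w) /\
  (exists c, forall v, hnorm v <= c * dsnorm (s v)).
Definition unitary_DS (l : option nat) (u : H -> nat -> H) : Prop :=
  ds_linear u /\ (forall v, in_DS l (u v)) /\
  (forall w, in_DS l w -> exists v, u v = w) /\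
  (forall v, dsnorm (u v) = hnorm v).
Definition dsum {d} (l : option nat) (xs : nat -> tuple d)
  : Fin.t d -> (nat -> H) -> (nat -> H) :=
  fun i w n => if inrng l n then xs n i (w n) else hs_zero H.
Definition diag2 {d} (x y : tuple d) := dsum (Some 2%nat) (fun n => match n with O => x | _ => y end).
(* y = s^{-1} z s  <->  s o y = z o s  (s bijective onto H^(l)) *)
Definition conj_DS {d} (s : H -> nat -> H) (z : Fin.t d -> (nat -> H) -> (nat -> H))
  (y : tuple d) : Prop := forall i v, s (y i v) = z i (s v).

Definition norm_interior {d} (A : tuple d -> Prop) (x : tuple d) : Prop :=
  exists eps, 0 < eps /\ forall y, is_BHd y -> tnorm (tsub y x) < eps -> A y.

Definition nc_exhaustion {d} (Om : tuple d -> Prop) (Ok : nat -> tuple d -> Prop) : Prop :=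
  (forall k x, Ok k x -> norm_interior (Ok (S k)) x) /\
  (forall x, Om x <-> exists k, Ok k x) /\
  (forall k, exists M, forall x, Ok k x -> tnorm x <= M) /\
  (forall k, unitarily_invariant (Ok k)) /\
  (forall k l (xs : nat -> tuple d), valid_len l ->
     (forall n, inrng l n = true -> Ok k (xs n)) ->
     exists u, unitary_DS l u /\ exists y, Ok k y /\ conj_DS u (dsum l xs) y).

Definition sot_nbhd {d} (x : tuple d) (vs : list H) (eps : R) (y : tuple d) : Prop :=
  forall i v, In v vs -> hnorm (vsub (y i v) (x i v)) < eps.
Definition sot_closed {d} (A : tuple d -> Prop) : Prop :=
  forall x, is_BHd x -> ~ A x ->
    exists vs eps, 0 < eps /\ forall y, is_BHd y -> sot_nbhd x vs eps y -> ~ A y.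
Definition sot_continuous_on {d r} (A : tuple d -> Prop) (f : tuple d -> tuple r) : Prop :=
  forall x, A x -> forall ws eps, 0 < eps ->
    exists vs delta, 0 < delta /\
      forall y, A y -> sot_nbhd x vs delta y -> sot_nbhd (f x) ws eps (f y).

Definition strong_exhaustion {d} (Om : tuple d -> Prop) (Ok : nat -> tuple d -> Prop) : Prop :=
  nc_exhaustion Om Ok /\
  (forall k, sot_closed (Ok k)) /\
  (forall k, exists eps, 0 < eps /\
     forall x, is_BHd x -> (exists y, Ok k y /\ tnorm (tsub x y) < eps) -> Ok (S k) x).

Definition nc_function {d r} (Om : tuple d -> Prop) (f : tuple d -> tuple r) : Prop :=
  forall x y, Om x -> Om y -> forall s, bounded_invertible (Some 2%nat) s ->
    forall w, Om w -> conj_DS s (diag2 x y) w -> conj_DS s (diag2 (f x) (f y)) (f w).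

Definition strong_nc_function {d r} (Om : tuple d -> Prop) (f : tuple d -> tuple r) : Prop :=
  nc_function Om f /\
  exists Ok, strong_exhaustion Om Ok /\ forall k, sot_continuous_on (Ok k) f.

Definition frechet_deriv {d r} (Om : tuple d -> Prop) (f : tuple d -> tuple r)
  (x : tuple d) (L : tuple d -> tuple r) : Prop :=
  (forall h, is_BHd h -> is_BHd (L h)) /\
  (forall h1 h2, is_BHd h1 -> is_BHd h2 -> L (tadd h1 h2) = tadd (L h1) (L h2)) /\
  (forall a h, is_BHd h -> L (tscal a h) = tscal a (L h)) /\
  (exists M, forall h, is_BHd h -> tnorm (L h) <= M * tnorm h) /\
  (forall eps, 0 < eps -> exists delta, 0 < delta /\
     forall h, is_BHd h -> tnorm h < delta -> Om (tadd x h) ->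
       tnorm (tsub (tsub (f (tadd x h)) (f x)) (L h)) <= eps * tnorm h).

Definition injective_on_BH {d r} (L : tuple d -> tuple r) : Prop :=
  forall h, is_BHd h -> L h = tzero -> h = tzero.

Definition bounded_below {d r} (L : tuple d -> tuple r) : Prop :=
  exists C, 0 < C /\ forall h, is_BHd h -> C * tnorm h <= tnorm (L h).

End Ops.

(* Main.v *)
(** Conjugating by [(1 L; 0 1)] shows that an NC function preserves intertwinings, [x L = L y ->
    f(x) L = L f(y)].  Hence [f (x h; 0 y)] is again upper triangular; its corner is homogeneous and
    additive in [h], and for [x = y] it is the derivative of [f] at [x].

    If [Df(x)] is not bounded below, take [h_n] and unit vectors [v_n] with [|h_n| <= 1],
    [|h_n v_n| >= 1/2] and [Df(x) h_n -> 0].  An orthonormal basis adapted to [(x, h_n)] and [v_n]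
    provides unitaries [u_n] with [u_n e_0 = v_n] such that [u_n* (x, h_n) u_n] has a strong limit
    [(X, K)] along an ultrafilter.  Then [X] stays in the domain because the exhausting sets are strongly
    closed and unitarily invariant, [K e_0 <> 0], and strong continuity of [f] at the block tuples
    [(X cK; 0 X)] gives [Df(X) K = 0], contradicting injectivity. *)

(* The obstacle: closed balls of operators are compact in the weak operator topology, but the
   exhausting sets are closed and [f] is continuous for the strong one. Conjugation by unitaries
   costs nothing, since the sets are invariant and [f] commutes with it, and it buys strong
   compactness: when the support of a column is finite and the same for all [n], convergence of its
   entries is already norm convergence. Pinning [v_n] to one fixed vector keeps the lower bound
   alive; a strong limit of the [h_n] alone could be 0.

   The derivative is traded for a corner of a value of [f] because strong continuity is known for
   the values of [f] only. The degenerate pair appears at [X], not at [x], so injectivity is used at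
   another point than the one under study. As [Hinj] speaks of maps that are Fréchet derivatives,
   one has to be exhibited at [X]; hence the existence proof, whose estimates rest on the
   boundedness of [f] on each exhausting set. *)
From mathcomp Require filter.
From Stdlib Require Import Reals Lra Lia Classical ClassicalEpsilon FunctionalExtensionality List.
From Stdlib Require Cantor Vectors.Fin.
Require Import Defs.
Open Scope R_scope.

(** * Hilbert space preliminaries *)

Lemma choice_fun {A B : Type} (R : A -> B -> Prop) :
  (forall a, exists b, R a b) -> exists g : A -> B, forall a, R a (g a).
Proof.
  intros h. exists (fun a => proj1_sig (constructive_indefinite_description _ (h a))).
  intros a. apply proj2_sig.
Qed.

Lemma Rabs_le_inv (x a : R) : Rabs x <= a -> - a <= x <= a.
Proof. unfold Rabs. destruct (Rcase_abs x); lra. Qed.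

Definition Copp (a : Cx) : Cx := mkCx (- Cre a) (- Cim a).
Definition Csub (a b : Cx) : Cx := Cadd a (Copp b).
Definition RC (t : R) : Cx := mkCx t 0.
Definition Cmod (a : Cx) : R := sqrt (Cre a ^ 2 + Cim a ^ 2).

Lemma Cx_ext (a b : Cx) : Cre a = Cre b -> Cim a = Cim b -> a = b.
Proof. destruct a, b; simpl; congruence. Qed.

Lemma Cx_ring_theory : ring_theory C0 C1 Cadd Cmul Csub Copp (@eq Cx).
Proof. split; intros; apply Cx_ext; simpl; ring. Qed.
Add Ring Cx_ring : Cx_ring_theory.

Lemma RC_mul (s t : R) : RC (s * t) = Cmul (RC s) (RC t).
Proof. apply Cx_ext; simpl; ring. Qed.

Lemma RC_opp1 : RC (-1) = Copp C1.
Proof. apply Cx_ext; simpl; ring. Qed.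

Lemma Cmod_nonneg (a : Cx) : 0 <= Cmod a.
Proof. apply sqrt_pos. Qed.

Lemma Cmod_sqr (a : Cx) : Cmod a ^ 2 = Cre a ^ 2 + Cim a ^ 2.
Proof. unfold Cmod. rewrite pow2_sqrt; [reflexivity | nra]. Qed.

Lemma Cmod_eq0 (a : Cx) : Cmod a = 0 -> a = C0.
Proof.
  intros h. pose proof (Cmod_sqr a) as e. rewrite h in e.
  pose proof (pow2_ge_0 (Cre a)). pose proof (pow2_ge_0 (Cim a)).
  apply Cx_ext; simpl.
  - destruct (Req_dec (Cre a) 0) as [z|n]; [exact z|]. pose proof (pow_nonzero _ 2 n). lra.
  - destruct (Req_dec (Cim a) 0) as [z|n]; [exact z|]. pose proof (pow_nonzero _ 2 n). lra.
Qed.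

Lemma Cmod_RC (t : R) : Cmod (RC t) = Rabs t.
Proof.
  unfold Cmod, RC; simpl.
  replace (t * (t * 1) + 0 * (0 * 1)) with (Rsqr t) by (unfold Rsqr; ring).
  apply sqrt_Rsqr_abs.
Qed.

Lemma Cmod_le (a : Cx) (e : R) : Rabs (Cre a) <= e -> Rabs (Cim a) <= e -> Cmod a <= 2 * e.
Proof.
  intros h1 h2.
  assert (0 <= e) by (pose proof (Rabs_pos (Cre a)); lra).
  apply (conj (Rabs_pos _)), (pow_incr _ _ 2) in h1.
  apply (conj (Rabs_pos _)), (pow_incr _ _ 2) in h2.
  rewrite pow2_abs in h1, h2.
  pose proof (Cmod_sqr a); pose proof (Cmod_nonneg a). nra.
Qed.

Notation "u +' v" := (hs_add _ u v) (at level 50, left associativity).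
Notation "u -' v" := (vsub u v) (at level 50, left associativity).
Notation "a *' v" := (hs_scal _ a v) (at level 40, left associativity).
Notation "0'" := (hs_zero _).
Notation "<< u , v >>" := (hs_inner _ u v) (at level 0, u at level 99, v at level 99).

Section Hilbert.
Context {H : HilbertSpace}.
Implicit Types u v w : H.

Lemma hs_add_zero_l v : 0' +' v = v.
Proof. rewrite hs_add_comm; apply hs_add_zero. Qed.

Lemma hs_add_cancel u v w : u +' w = v +' w -> u = v.
Proof.
  intros h. rewrite <- (hs_add_zero H u), <- (hs_add_zero H v), <- (hs_add_opp H w).
  rewrite !hs_add_assoc, h. reflexivity.
Qed.

Lemma hs_scal_zero v : C0 *' v = 0'.
Proof.
  apply (hs_add_cancel _ _ (C0 *' v)).
  rewrite <- hs_scal_addl, hs_add_zero_l. f_equal. ring.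
Qed.

Lemma hs_opp_scal v : hs_opp H v = Copp C1 *' v.
Proof.
  apply (hs_add_cancel _ _ v). rewrite hs_add_comm, hs_add_opp.
  rewrite <- (hs_scal_one H v) at 2. rewrite <- hs_scal_addl.
  replace (Cadd (Copp C1) C1) with C0 by ring. rewrite hs_scal_zero; reflexivity.
Qed.

Lemma inner_zero_l v : <<0', v>> = C0.
Proof. rewrite <- (hs_scal_zero v), hs_inner_scall. ring. Qed.

Lemma inner_opp_l u v : <<hs_opp H u, v>> = Copp <<u, v>>.
Proof. rewrite hs_opp_scal, hs_inner_scall. ring. Qed.

Lemma inner_sub_l u v w : <<u -' v, w>> = Csub <<u, w>> <<v, w>>.
Proof. unfold vsub. rewrite hs_inner_addl, inner_opp_l. ring. Qed.

Lemma inner_scal_r a u v : <<u, a *' v>> = Cmul (Cconj a) <<u, v>>.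
Proof.
  rewrite hs_inner_conj, hs_inner_scall, (hs_inner_conj H u v).
  apply Cx_ext; simpl; ring.
Qed.

Lemma inner_zero_r v : <<v, 0'>> = C0.
Proof. rewrite hs_inner_conj, inner_zero_l. apply Cx_ext; simpl; ring. Qed.

Lemma inner_self_im v : Cim <<v, v>> = 0.
Proof. pose proof (f_equal Cim (hs_inner_conj H v v)) as h; simpl in h. lra. Qed.

Lemma inner_self_nonneg v : 0 <= Cre <<v, v>>.
Proof.
  destruct (classic (v = 0')) as [->|h].
  - rewrite inner_zero_l; simpl; lra.
  - left; apply hs_inner_pos; exact h.
Qed.

Lemma inner_ext u v : (forall w, <<u, w>> = <<v, w>>) -> u = v.
Proof.
  intros h. apply (hs_add_cancel _ _ (hs_opp H v)). rewrite hs_add_opp.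
  apply NNPP; intros n. apply hs_inner_pos in n.
  rewrite hs_inner_addl, inner_opp_l, h in n.
  replace (Cadd _ _) with C0 in n by ring. simpl in n; lra.
Qed.

End Hilbert.

(* Vector space identities are checked after pairing with an arbitrary vector,
   which turns them into ring identities in [Cx]. *)
Ltac vring :=
  apply inner_ext; let w := fresh "w" in intro w;
  repeat rewrite ?inner_sub_l, ?hs_inner_addl, ?hs_inner_scall, ?inner_opp_l, ?inner_zero_l;
  ring.

Section Norm.
Context {H : HilbertSpace}.
Implicit Types u v w : H.

(** Norms only see the real part of the inner product, so estimates with [ip] stay in [R], within
    reach of [lra] and [nra]. *)
Definition ip u v : R := Cre <<u, v>>.

Lemma ip_sym u v : ip u v = ip v u.
Proof. unfold ip. rewrite hs_inner_conj; reflexivity. Qed.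

Lemma ip_add_l u v w : ip (u +' v) w = ip u w + ip v w.
Proof. unfold ip. rewrite hs_inner_addl; reflexivity. Qed.

Lemma ip_add_r u v w : ip w (u +' v) = ip w u + ip w v.
Proof. rewrite !(ip_sym w). apply ip_add_l. Qed.

Lemma ip_RC_l t u v : ip (RC t *' u) v = t * ip u v.
Proof. unfold ip. rewrite hs_inner_scall; simpl; ring. Qed.

Lemma ip_RC_r t u v : ip v (RC t *' u) = t * ip v u.
Proof. rewrite !(ip_sym v). apply ip_RC_l. Qed.

Lemma vsub_RC u v : u -' v = u +' RC (-1) *' v.
Proof. rewrite RC_opp1. vring. Qed.

Lemma ip_self_nonneg v : 0 <= ip v v.
Proof. apply inner_self_nonneg. Qed.

Lemma hnorm_nonneg v : 0 <= hnorm v.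
Proof. apply sqrt_pos. Qed.

Lemma hnorm_sqr v : hnorm v ^ 2 = ip v v.
Proof. apply pow2_sqrt, ip_self_nonneg. Qed.

Lemma hnorm_zero : hnorm (0' : H) = 0.
Proof. unfold hnorm. rewrite inner_zero_l. apply sqrt_0. Qed.

Lemma hnorm_eq0 v : hnorm v <= 0 -> v = 0'.
Proof.
  intros h. apply NNPP; intros n. apply hs_inner_pos in n.
  pose proof (hnorm_sqr v). unfold ip in *. pose proof (hnorm_nonneg v). nra.
Qed.

Lemma sqr_le_le (a b : R) : 0 <= b -> a ^ 2 <= b ^ 2 -> a <= b.
Proof. intros. nra. Qed.

Lemma sqr_eq_eq (a b : R) : 0 <= a -> 0 <= b -> a ^ 2 = b ^ 2 -> a = b.
Proof. intros. apply Rle_antisym; apply sqr_le_le; lra. Qed.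

Lemma hnorm_scal a v : hnorm (a *' v) = Cmod a * hnorm v.
Proof.
  apply sqr_eq_eq.
  - apply hnorm_nonneg.
  - apply Rmult_le_pos; [apply Cmod_nonneg | apply hnorm_nonneg].
  - rewrite Rpow_mult_distr, Cmod_sqr, !hnorm_sqr. unfold ip.
    rewrite hs_inner_scall, inner_scal_r. simpl.
    rewrite inner_self_im. ring.
Qed.

Lemma hnorm_RC t v : hnorm (RC t *' v) = Rabs t * hnorm v.
Proof. rewrite hnorm_scal, Cmod_RC; reflexivity. Qed.

Lemma cauchy_schwarz u v : ip u v <= hnorm u * hnorm v.
Proof.
  destruct (Req_dec (hnorm v) 0) as [e|n].
  - assert (v = 0') by (apply hnorm_eq0; lra). subst v.
    unfold ip. rewrite inner_zero_r, hnorm_zero; simpl; lra.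
  - pose proof (hnorm_nonneg v). pose proof (hnorm_nonneg u).
    (* The real [t] that minimises the norm of [u + t v]. *)
    set (t := - (ip u v / (hnorm v ^ 2))).
    pose proof (ip_self_nonneg (u +' RC t *' v)) as h.
    rewrite !ip_add_l, !ip_add_r, !ip_RC_l, !ip_RC_r, (ip_sym v u) in h.
    rewrite <- !hnorm_sqr in h.
    assert (e : t * hnorm v ^ 2 = - ip u v) by (unfold t; field; lra).
    assert (0 < hnorm v ^ 2) by nra.
    assert (ip u v ^ 2 <= (hnorm u * hnorm v) ^ 2).
    { assert (t * ip u v = - (ip u v ^ 2) / hnorm v ^ 2) by (unfold t; field; lra).
      assert (h2 : 0 <= (hnorm u ^ 2 + t * ip u v) * hnorm v ^ 2)
        by (apply Rmult_le_pos; [nra | lra]).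
      replace ((hnorm u ^ 2 + t * ip u v) * hnorm v ^ 2)
        with (hnorm u ^ 2 * hnorm v ^ 2 + ip u v * (t * hnorm v ^ 2)) in h2 by ring.
      rewrite e in h2. nra. }
    apply sqr_le_le; [nra | assumption].
Qed.

Lemma hnorm_add u v : hnorm (u +' v) <= hnorm u + hnorm v.
Proof.
  pose proof (hnorm_nonneg u); pose proof (hnorm_nonneg v).
  apply sqr_le_le; [lra|].
  rewrite hnorm_sqr, !ip_add_l, !ip_add_r, (ip_sym v u), <- !hnorm_sqr.
  pose proof (cauchy_schwarz u v). nra.
Qed.

Lemma hnorm_opp1 v : hnorm (RC (-1) *' v) = hnorm v.
Proof. rewrite hnorm_RC, Rabs_left by lra. ring. Qed.

Lemma hnorm_sub u v : hnorm (u -' v) <= hnorm u + hnorm v.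
Proof. rewrite vsub_RC. pose proof (hnorm_add u (RC (-1) *' v)). rewrite hnorm_opp1 in *. lra. Qed.

Lemma hnorm_sub_sym u v : hnorm (u -' v) = hnorm (v -' u).
Proof.
  rewrite <- (hnorm_opp1 (v -' u)). f_equal. rewrite RC_opp1. vring.
Qed.

Lemma hnorm_sub_triangle u v w : hnorm (u -' w) <= hnorm (u -' v) + hnorm (v -' w).
Proof.
  replace (u -' w) with ((u -' v) +' (v -' w)) by vring. apply hnorm_add.
Qed.

Lemma hnorm_sub_self v : hnorm (v -' v) = 0.
Proof. replace (v -' v) with (0' : H) by vring. apply hnorm_zero. Qed.

Lemma hnorm_sub_zero v : hnorm (v -' 0') = hnorm v.
Proof. f_equal. vring. Qed.

Lemma vsub_eq0 u v : u -' v = 0' -> u = v.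
Proof. intros h. replace u with ((u -' v) +' v) by vring. rewrite h. apply hs_add_zero_l. Qed.

Lemma hnorm_sub_eq u v : (forall e, 0 < e -> hnorm (u -' v) <= e) -> u = v.
Proof.
  intros h. apply vsub_eq0, hnorm_eq0.
  apply Rnot_lt_le; intros n. specialize (h (hnorm (u -' v) / 2)). lra.
Qed.

Lemma inner_re_abs u v : Rabs (Cre <<u, v>>) <= hnorm u * hnorm v.
Proof.
  apply Rabs_le. split; [|apply cauchy_schwarz].
  pose proof (cauchy_schwarz u (RC (-1) *' v)) as h.
  rewrite ip_RC_r, hnorm_opp1 in h. unfold ip in h. lra.
Qed.

(** The real part of the inner product of [u] with [i v] is the imaginary part of that of [u] with
    [v]. *)
Lemma inner_im_abs u v : Rabs (Cim <<u, v>>) <= hnorm u * hnorm v.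
Proof.
  pose proof (inner_re_abs u (mkCx 0 1 *' v)) as h.
  rewrite hnorm_scal, inner_scal_r in h. unfold Cmod in h; simpl in h.
  replace (0 * (0 * 1) + 1 * (1 * 1)) with 1 in h by ring. rewrite sqrt_1 in h.
  replace (0 * Cre <<u, v>> - - (1) * Cim <<u, v>>) with (Cim <<u, v>>) in h by ring.
  lra.
Qed.

Lemma limit_unique (s : nat -> H) l l' :
  (forall e, 0 < e -> exists N, forall n, (N <= n)%nat -> hnorm (s n -' l) < e) ->
  (forall e, 0 < e -> exists N, forall n, (N <= n)%nat -> hnorm (s n -' l') < e) ->
  l = l'.
Proof.
  intros h1 h2. apply hnorm_sub_eq. intros e he.
  destruct (h1 (e / 2)) as [N1 n1]; [lra|]. destruct (h2 (e / 2)) as [N2 n2]; [lra|].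
  specialize (n1 (N1 + N2)%nat ltac:(lia)). specialize (n2 (N1 + N2)%nat ltac:(lia)).
  pose proof (hnorm_sub_triangle l (s (N1 + N2)%nat) l') as t.
  rewrite (hnorm_sub_sym l (s _)) in t. lra.
Qed.

End Norm.

(** * Bounded operators and the operator norm *)

Section Operators.
Context {H : HilbertSpace}.
Implicit Types (u v w : H) (S T : H -> H).

Lemma lin_add T u v : is_linear T -> T (u +' v) = T u +' T v.
Proof. intros h; apply h. Qed.

Lemma lin_scal T a v : is_linear T -> T (a *' v) = a *' T v.
Proof. intros h; apply h. Qed.

Lemma lin_sub T u v : is_linear T -> T (u -' v) = T u -' T v.
Proof. intros h. rewrite !vsub_RC, lin_add, lin_scal; auto. Qed.

Lemma lin_zero T : is_linear T -> T 0' = 0'.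
Proof. intros h. pose proof (lin_scal T C0 0' h) as e. rewrite !hs_scal_zero in e. exact e. Qed.

Definition bounded_by T (M : R) : Prop := forall v, hnorm (T v) <= M * hnorm v.

Lemma BH_lin T : is_BH T -> is_linear T.
Proof. intros h; apply h. Qed.

Lemma BH_bound T : is_BH T -> exists M, 0 <= M /\ bounded_by T M.
Proof.
  intros [_ [M h]]. exists (Rabs M). split; [apply Rabs_pos|]. intros v.
  eapply Rle_trans; [apply h|]. apply Rmult_le_compat_r; [apply hnorm_nonneg | apply Rle_abs].
Qed.

Lemma BH_comp S T : is_BH S -> is_BH T -> is_BH (fun v => S (T v)).
Proof.
  intros hS hT. destruct (BH_bound S hS) as [M [m0 hM]], (BH_bound T hT) as [N [n0 hN]].
  apply BH_lin in hS, hT. split.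
  - split; intros; [rewrite (lin_add T), lin_add | rewrite (lin_scal T), lin_scal]; auto.
  - exists (M * N). intros v. eapply Rle_trans; [apply hM|].
    rewrite Rmult_assoc. apply Rmult_le_compat_l; auto.
Qed.

Lemma BH_add S T : is_BH S -> is_BH T -> is_BH (fun v => S v +' T v).
Proof.
  intros [hS [M hM]] [hT [N hN]]. split.
  - split; intros; [rewrite (lin_add S), (lin_add T) | rewrite (lin_scal S), (lin_scal T)];
      auto; vring.
  - exists (M + N). intros v. eapply Rle_trans; [apply hnorm_add|].
    specialize (hM v); specialize (hN v); lra.
Qed.

Lemma BH_scal a T : is_BH T -> is_BH (fun v => a *' T v).
Proof.
  intros hT. destruct (BH_bound T hT) as [M [m0 hM]]. apply BH_lin in hT. split.
  - split; intros; [rewrite (lin_add T) | rewrite (lin_scal T)]; auto; vring.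
  - exists (Cmod a * M). intros v. rewrite hnorm_scal, Rmult_assoc.
    apply Rmult_le_compat_l; [apply Cmod_nonneg | apply hM].
Qed.

Lemma BH_sub S T : is_BH S -> is_BH T -> is_BH (fun v => S v -' T v).
Proof.
  intros hS hT.
  replace (fun v => S v -' T v) with (fun v => S v +' RC (-1) *' T v)
    by (extensionality v; symmetry; apply vsub_RC).
  apply BH_add; [|apply BH_scal]; assumption.
Qed.

Lemma BH_zero : is_BH (fun _ : H => 0').
Proof.
  split; [split; intros; vring|]. exists 0. intros. rewrite hnorm_zero. lra.
Qed.

Lemma BH_id : is_BH (fun v : H => v).
Proof. split; [split; auto|]. exists 1. intros; lra. Qed.

(** [Rsup] takes the default value 0 when there is no least upper bound, which includes the empty
    set; [0 <= M] covers that case. *)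
Lemma Rsup_le (E : R -> Prop) M : 0 <= M -> (forall a, E a -> a <= M) -> Rsup E <= M.
Proof.
  intros h0 h. unfold Rsup.
  destruct (constructive_indefinite_description _ (Rsup_ex E)) as [m [hm|[n e]]]; simpl.
  - apply hm. exact h.
  - rewrite e. exact h0.
Qed.

Lemma le_Rsup (E : R -> Prop) M a : (forall a, E a -> a <= M) -> E a -> a <= Rsup E.
Proof.
  intros h ha. unfold Rsup.
  destruct (constructive_indefinite_description _ (Rsup_ex E)) as [m [hm|[n e]]]; simpl.
  - apply hm, ha.
  - exfalso. apply n. destruct (completeness E) as [l hl]; [exists M; exact h | exists a; exact ha |].
    exists l; exact hl.
Qed.

Lemma opnorm_le T M : 0 <= M -> bounded_by T M -> opnorm T <= M.
Proof.
  intros h0 h. apply Rsup_le; [exact h0|]. intros a [v [hv ->]].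
  eapply Rle_trans; [apply h|]. rewrite <- (Rmult_1_r M) at 2.
  apply Rmult_le_compat_l; assumption.
Qed.

Lemma le_opnorm T v : is_BH T -> hnorm v <= 1 -> hnorm (T v) <= opnorm T.
Proof.
  intros h hv. destruct (BH_bound T h) as [M [m0 hM]].
  apply le_Rsup with (M := M).
  - intros a [w [hw ->]]. eapply Rle_trans; [apply hM|].
    rewrite <- (Rmult_1_r M) at 2. apply Rmult_le_compat_l; assumption.
  - exists v; auto.
Qed.

Lemma opnorm_nonneg T : is_BH T -> 0 <= opnorm T.
Proof.
  intros h. pose proof (le_opnorm T 0' h) as e.
  rewrite lin_zero, hnorm_zero in e by (apply BH_lin, h). lra.
Qed.

Lemma normalize v : 0 < hnorm v ->
  hnorm (RC (/ hnorm v) *' v) = 1 /\ v = RC (hnorm v) *' (RC (/ hnorm v) *' v).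
Proof.
  intros h. split.
  - rewrite hnorm_RC, Rabs_right; [field; lra | apply Rle_ge; left; apply Rinv_0_lt_compat, h].
  - rewrite hs_scal_assoc, <- RC_mul, Rinv_r by lra. symmetry; apply hs_scal_one.
Qed.

Lemma bounded_by_unit T M : is_linear T ->
  (forall v, hnorm v = 1 -> hnorm (T v) <= M) -> bounded_by T M.
Proof.
  intros hl h v. destruct (Req_dec (hnorm v) 0) as [e|n].
  - assert (v = 0') by (apply hnorm_eq0; lra). subst v.
    rewrite lin_zero, hnorm_zero by assumption. lra.
  - pose proof (hnorm_nonneg v). destruct (normalize v) as [h1 h2]; [lra|].
    rewrite h2 at 1. rewrite lin_scal, hnorm_RC, Rabs_right by (auto; lra).
    specialize (h _ h1). rewrite Rmult_comm. apply Rmult_le_compat_r; lra.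
Qed.

Lemma opnorm_bound T : is_BH T -> bounded_by T (opnorm T).
Proof.
  intros h. apply bounded_by_unit; [apply BH_lin, h|].
  intros v hv. apply le_opnorm; [exact h | lra].
Qed.

End Operators.

(** * Tuples of operators and their norm *)

Section Tuples.
Context {H : HilbertSpace}.

Definition tuple_bounded_by {d} (x : @tuple H d) (M : R) : Prop := forall i, bounded_by (x i) M.

Lemma Fin_bound (d : nat) (g : Fin.t d -> R) : exists M, 0 <= M /\ forall i, g i <= M.
Proof.
  induction d as [|d IH].
  - exists 0. split; [lra|]. intros i; inversion i.
  - destruct (IH (fun i => g (Fin.FS i))) as [M [m0 h]].
    exists (Rmax M (g Fin.F1)). split; [eapply Rle_trans; [exact m0 | apply Rmax_l]|].
    intros i. pattern i. apply Fin.caseS'; [apply Rmax_r|].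
    intros j. eapply Rle_trans; [apply h | apply Rmax_l].
Qed.

Lemma tnorm_le {d} (x : @tuple H d) M : 0 <= M -> tuple_bounded_by x M -> tnorm x <= M.
Proof.
  intros h0 h. apply Rsup_le; [exact h0|]. intros a [i ->]. apply opnorm_le; auto.
Qed.

Lemma tnorm_bound {d} (x : @tuple H d) : is_BHd x -> tuple_bounded_by x (tnorm x).
Proof.
  intros h i v. eapply Rle_trans; [apply opnorm_bound, h|].
  apply Rmult_le_compat_r; [apply hnorm_nonneg|].
  destruct (Fin_bound d (fun i => opnorm (x i))) as [M [_ hM]].
  apply le_Rsup with (M := M); [intros a [j ->]; apply hM | exists i; reflexivity].
Qed.

Lemma bounded_by_weaken (T : H -> H) M N : M <= N -> bounded_by T M -> bounded_by T N.
Proof.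
  intros h hM v. eapply Rle_trans; [apply hM|].
  apply Rmult_le_compat_r; [apply hnorm_nonneg | exact h].
Qed.

Lemma tuple_bounded_by_tnorm {d} (x : @tuple H d) M : is_BHd x -> tnorm x <= M -> tuple_bounded_by x M.
Proof. intros h hM i. eapply bounded_by_weaken; [exact hM | apply tnorm_bound, h]. Qed.

Lemma tnorm_nonneg {d} (x : @tuple H d) : is_BHd x -> 0 <= tnorm x.
Proof.
  intros h. unfold tnorm, Rsup.
  destruct (constructive_indefinite_description _ _) as [m [hm|[n e]]]; simpl; [|lra].
  destruct d as [|d].
  (* For [d = 0] the set is empty, so every real is an upper bound and none is least. *)
  - exfalso. assert (m <= m - 1); [|lra]. apply hm. intros a [i _]. inversion i.
  - eapply Rle_trans; [apply (opnorm_nonneg (x Fin.F1)), h|]. apply hm. exists Fin.F1; reflexivity.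
Qed.

Lemma tnorm_large {d} (x : @tuple H d) M : 0 <= M -> M < tnorm x ->
  is_BHd x -> exists i v, hnorm v = 1 /\ M < hnorm (x i v).
Proof.
  intros h0 h hx. apply NNPP; intros n. apply (Rlt_not_le _ _ h).
  apply tnorm_le; [exact h0|]. intros i. apply bounded_by_unit; [apply BH_lin, hx|].
  intros v hv. apply Rnot_lt_le. intros c. apply n. exists i, v. auto.
Qed.

Lemma BHd_tadd {d} (x y : @tuple H d) : is_BHd x -> is_BHd y -> is_BHd (tadd x y).
Proof. intros hx hy i. apply BH_add; [apply hx | apply hy]. Qed.

Lemma BHd_tsub {d} (x y : @tuple H d) : is_BHd x -> is_BHd y -> is_BHd (tsub x y).
Proof. intros hx hy i. apply BH_sub; [apply hx | apply hy]. Qed.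

Lemma BHd_tscal {d} a (x : @tuple H d) : is_BHd x -> is_BHd (tscal a x).
Proof. intros hx i. apply BH_scal, hx. Qed.

Lemma tuple_ext {d} (x y : @tuple H d) : (forall i v, x i v = y i v) -> x = y.
Proof. intros h. extensionality i; extensionality v; apply h. Qed.

Lemma tnorm_tscal_le {d} a (x : @tuple H d) : is_BHd x -> tnorm (tscal a x) <= Cmod a * tnorm x.
Proof.
  intros h. pose proof (Cmod_nonneg a). pose proof (tnorm_nonneg x h).
  apply tnorm_le; [apply Rmult_le_pos; assumption|].
  intros i v. unfold tscal. rewrite hnorm_scal, Rmult_assoc.
  apply Rmult_le_compat_l; [assumption | apply tnorm_bound, h].
Qed.

Lemma tnorm_tadd_le {d} (x y : @tuple H d) : is_BHd x -> is_BHd y ->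
  tnorm (tadd x y) <= tnorm x + tnorm y.
Proof.
  intros hx hy. pose proof (tnorm_nonneg x hx). pose proof (tnorm_nonneg y hy).
  apply tnorm_le; [lra|]. intros i v. eapply Rle_trans; [apply hnorm_add|].
  pose proof (tnorm_bound x hx i v). pose proof (tnorm_bound y hy i v). lra.
Qed.

Lemma tnorm_eq0 {d} (x : @tuple H d) : is_BHd x -> tnorm x <= 0 -> x = tzero.
Proof.
  intros hx h. apply tuple_ext. intros i v. apply hnorm_eq0.
  eapply Rle_trans; [apply (tuple_bounded_by_tnorm x 0 hx h)|]. lra.
Qed.

End Tuples.

(** * Direct sums, intertwinings and derivatives *)

Section DirectSums.
Context {H : HilbertSpace}.
Implicit Types (u v w a b : H).

Definition single (n : nat) a : nat -> H := fun m => if Nat.eqb m n then a else 0'.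

Lemma psum_S (w : nat -> H) N : psum w (S N) = psum w N + hnorm (w (S N)) ^ 2.
Proof. reflexivity. Qed.

Lemma psum_le_psum (w : nat -> H) N N' : (N <= N')%nat -> psum w N <= psum w N'.
Proof.
  intros h. induction h; [lra|]. rewrite psum_S.
  pose proof (pow2_ge_0 (hnorm (w (S m)))). lra.
Qed.

Lemma psum_finite (w : nat -> H) N : (forall n, (N < n)%nat -> w n = 0') ->
  forall N', psum w N' <= psum w N.
Proof.
  intros h N'. destruct (Nat.le_gt_cases N' N) as [l|l]; [apply psum_le_psum, l|].
  induction l; rewrite psum_S, h, hnorm_zero by lia; lra.
Qed.

Lemma dsnorm_finite (w : nat -> H) N : (forall n, (N < n)%nat -> w n = 0') ->
  dsnorm w = sqrt (psum w N).
Proof.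
  intros h. unfold dsnorm. f_equal. apply Rle_antisym.
  - apply Rsup_le; [|intros a [N' ->]; apply psum_finite, h].
    apply cond_pos_sum. intros. apply pow2_ge_0.
  - apply le_Rsup with (M := psum w N); [intros a [N' ->]; apply psum_finite, h|].
    exists N; reflexivity.
Qed.

Lemma psum_single n a N : psum (single n a) N = if Nat.leb n N then hnorm a ^ 2 else 0.
Proof.
  induction N as [|N IH].
  - unfold psum, single; simpl. destruct n; simpl; [reflexivity|]. rewrite hnorm_zero; ring.
  - rewrite psum_S, IH. unfold single. destruct (Nat.eqb_spec (S N) n) as [<-|e].
    + rewrite Nat.leb_refl. destruct (Nat.leb_spec (S N) N); [lia|]. ring.
    + rewrite hnorm_zero. destruct (Nat.leb_spec n N), (Nat.leb_spec n (S N)); try lia; ring.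
Qed.

Lemma dsnorm_single n a : dsnorm (single n a) = hnorm a.
Proof.
  rewrite (dsnorm_finite _ n).
  - rewrite psum_single, Nat.leb_refl. apply sqrt_pow2, hnorm_nonneg.
  - intros m h. unfold single. destruct (Nat.eqb_spec m n); [lia | reflexivity].
Qed.

Lemma in_DS_finite l (w : nat -> H) N : (forall n, inrng l n = false -> w n = 0') ->
  (forall n, (N < n)%nat -> w n = 0') -> in_DS l w.
Proof.
  intros h h'. split; [exact h|]. exists (psum w N). apply psum_finite, h'.
Qed.

Lemma in_DS_single l n a : inrng l n = true -> in_DS l (single n a).
Proof.
  intros h. apply in_DS_finite with (N := n); intros m hm; unfold single;
    destruct (Nat.eqb_spec m n); try congruence; lia.
Qed.

Lemma unitary_DS_inj l (u : H -> nat -> H) v w : unitary_DS l u -> u v = u w -> v = w.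
Proof.
  intros [[ha hs] [_ [_ hn]]] h. apply vsub_eq0, hnorm_eq0.
  rewrite <- hn, vsub_RC, ha, hs, h, (dsnorm_finite _ 0).
  - unfold psum; simpl. rewrite <- vsub_RC, hnorm_sub_self.
    rewrite Rmult_0_l, sqrt_0. lra.
  - intros. rewrite <- vsub_RC. vring.
Qed.

(** [J] is the inverse of [u] restricted to the [n]-th summand. With [l = None] it recovers one
    tuple from an infinite direct sum. *)
Lemma unitary_DS_embedding l (u : H -> nat -> H) n : unitary_DS l u -> inrng l n = true ->
  exists J : H -> H, is_linear J /\ (forall a, hnorm (J a) = hnorm a) /\
    forall a, u (J a) = single n a.
Proof.
  intros hu hn.
  assert (ex : forall a, exists v, u v = single n a) by (intros; apply hu, in_DS_single, hn).
  exists (fun a => proj1_sig (constructive_indefinite_description _ (ex a))).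
  assert (e : forall a, u (proj1_sig (constructive_indefinite_description _ (ex a))) = single n a).
  { intros a. apply proj2_sig. }
  split; [|split; [|exact e]].
  - split; intros; apply (unitary_DS_inj l u); try exact hu.
    + rewrite (proj1 (proj1 hu)), !e. extensionality m. unfold single.
      destruct (Nat.eqb m n); [reflexivity | vring].
    + rewrite (proj2 (proj1 hu)), !e. extensionality m. unfold single.
      destruct (Nat.eqb m n); [reflexivity | vring].
  - intros a. rewrite <- (proj2 (proj2 (proj2 hu))), e. apply dsnorm_single.
Qed.

End DirectSums.

(* The Cuntz-type data of an identification of [H] with the orthogonal sum of two copies of [H]. *)
Record halves (H : HilbertSpace) := {
  hP1 : H -> H;
  hP2 : H -> H;
  hJ1 : H -> H;
  hJ2 : H -> H;
  P1_lin : is_linear hP1;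
  P2_lin : is_linear hP2;
  J1_lin : is_linear hJ1;
  J2_lin : is_linear hJ2;
  P1_J1 : forall v, hP1 (hJ1 v) = v;
  P2_J2 : forall v, hP2 (hJ2 v) = v;
  P1_J2 : forall v, hP1 (hJ2 v) = 0';
  P2_J1 : forall v, hP2 (hJ1 v) = 0';
  J_P : forall v, hJ1 (hP1 v) +' hJ2 (hP2 v) = v;
  halves_norm : forall v, hnorm v ^ 2 = hnorm (hP1 v) ^ 2 + hnorm (hP2 v) ^ 2
}.
Arguments hP1 {H}. Arguments hP2 {H}. Arguments hJ1 {H}. Arguments hJ2 {H}.

Section Halves.
Context {H : HilbertSpace}.
Implicit Types (u v w a b : H).

Definition two a b : nat -> H := fun n => match n with 0%nat => a | 1%nat => b | _ => 0' end.

Lemma two_eq (w : nat -> H) : (forall n, inrng (Some 2%nat) n = false -> w n = 0') ->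
  w = two (w 0%nat) (w 1%nat).
Proof. intros h. extensionality n. destruct n as [|[|n]]; [| | apply h]; reflexivity. Qed.

Lemma in_DS_two a b : in_DS (Some 2%nat) (two a b).
Proof.
  apply in_DS_finite with (N := 1%nat); intros [|[|n]] h; try reflexivity; try discriminate; lia.
Qed.

Lemma dsnorm_two_sqr a b : dsnorm (two a b) ^ 2 = hnorm a ^ 2 + hnorm b ^ 2.
Proof.
  rewrite (dsnorm_finite _ 1).
  - unfold psum; simpl sum_f_R0. simpl two. apply pow2_sqrt. nra.
  - intros [|[|n]] h; [lia | lia | reflexivity].
Qed.

(** The direct sum axiom of an NC domain supplies such a [u], so the splitting of [H] is taken from
    the domain itself. *)
Lemma exists_halves (u : H -> nat -> H) : unitary_DS (Some 2%nat) u ->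
  exists h : halves H, forall v, u v = two (hP1 h v) (hP2 h v).
Proof.
  intros hu.
  destruct (unitary_DS_embedding (Some 2%nat) u 0 hu eq_refl) as [j1 [l1 [n1 e1]]].
  destruct (unitary_DS_embedding (Some 2%nat) u 1 hu eq_refl) as [j2 [l2 [n2 e2]]].
  assert (eu : forall v, u v = two (u v 0%nat) (u v 1%nat)).
  { intros v. apply two_eq. apply (proj1 (proj2 hu) v). }
  unshelve eexists (Build_halves H (fun v => u v 0%nat) (fun v => u v 1%nat) j1 j2
    _ _ l1 l2 _ _ _ _ _ _).
  - split; intros; [rewrite (proj1 (proj1 hu)) | rewrite (proj2 (proj1 hu))]; reflexivity.
  - split; intros; [rewrite (proj1 (proj1 hu)) | rewrite (proj2 (proj1 hu))]; reflexivity.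
  - intros v; simpl; rewrite e1; reflexivity.
  - intros v; simpl; rewrite e2; reflexivity.
  - intros v; simpl; rewrite e2; reflexivity.
  - intros v; simpl; rewrite e1; reflexivity.
  - intros v; simpl. apply (unitary_DS_inj _ u _ _ hu).
    rewrite (proj1 (proj1 hu)), e1, e2, (eu v).
    extensionality n. destruct n as [|[|n]]; unfold single; simpl; vring.
  - intros v; cbn beta. rewrite <- dsnorm_two_sqr, <- eu, (proj2 (proj2 (proj2 hu))). reflexivity.
  - exact eu.
Qed.

Context (hv : halves H).
Local Notation P1 := (hP1 hv).
Local Notation P2 := (hP2 hv).
Local Notation J1 := (hJ1 hv).
Local Notation J2 := (hJ2 hv).

Lemma P1_J v w : P1 (J1 v +' J2 w) = v.
Proof. rewrite lin_add, P1_J1, P1_J2 by apply P1_lin. apply hs_add_zero. Qed.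

Lemma P2_J v w : P2 (J1 v +' J2 w) = w.
Proof. rewrite lin_add, P2_J1, P2_J2 by apply P2_lin. apply hs_add_zero_l. Qed.

Lemma halves_ext v w : P1 v = P1 w -> P2 v = P2 w -> v = w.
Proof. intros h1 h2. rewrite <- (J_P _ hv v), <- (J_P _ hv w), h1, h2. reflexivity. Qed.

Lemma hnorm_J_sqr v w : hnorm (J1 v +' J2 w) ^ 2 = hnorm v ^ 2 + hnorm w ^ 2.
Proof. rewrite (halves_norm _ hv), P1_J, P2_J. reflexivity. Qed.

Lemma hnorm_P1 v : hnorm (P1 v) <= hnorm v.
Proof. pose proof (halves_norm _ hv v). pose proof (hnorm_nonneg v). nra. Qed.

Lemma hnorm_P2 v : hnorm (P2 v) <= hnorm v.
Proof. pose proof (halves_norm _ hv v). pose proof (hnorm_nonneg v). nra. Qed.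

Lemma hnorm_J1 v : hnorm (J1 v) = hnorm v.
Proof.
  apply sqr_eq_eq; try apply hnorm_nonneg.
  rewrite (halves_norm _ hv), P1_J1, P2_J1, hnorm_zero. ring.
Qed.

Lemma hnorm_J2 v : hnorm (J2 v) = hnorm v.
Proof.
  apply sqr_eq_eq; try apply hnorm_nonneg.
  rewrite (halves_norm _ hv), P1_J2, P2_J2, hnorm_zero. ring.
Qed.

Lemma BH_P1 : is_BH P1.
Proof. split; [apply P1_lin|]. exists 1. intros. rewrite Rmult_1_l. apply hnorm_P1. Qed.
Lemma BH_P2 : is_BH P2.
Proof. split; [apply P2_lin|]. exists 1. intros. rewrite Rmult_1_l. apply hnorm_P2. Qed.
Lemma BH_J1 : is_BH J1.
Proof. split; [apply J1_lin|]. exists 1. intros. rewrite Rmult_1_l, hnorm_J1. lra. Qed.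
Lemma BH_J2 : is_BH J2.
Proof. split; [apply J2_lin|]. exists 1. intros. rewrite Rmult_1_l, hnorm_J2. lra. Qed.

(** This is the identification of [H] with two copies followed by [(1 L; 0 1)]. The inverse shear
    has [-L] in the corner, so [2 + M] serves in both directions. *)
Lemma bounded_invertible_shear (L : H -> H) : is_BH L ->
  bounded_invertible (Some 2%nat) (fun v => two (P1 v +' L (P2 v)) (P2 v)).
Proof.
  intros hL. destruct (BH_bound L hL) as [M [m0 hM]]. apply BH_lin in hL.
  pose proof (P1_lin _ hv) as l1. pose proof (P2_lin _ hv) as l2.
  split; [|split; [|split; [|split]]].
  - split; intros; extensionality n; destruct n as [|[|n]]; simpl;
      rewrite ?(lin_add P1), ?(lin_add P2), ?(lin_add L) by assumption;
      rewrite ?(lin_scal P1), ?(lin_scal P2), ?(lin_scal L) by assumption; vring.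
  - intros v. apply in_DS_two.
  - exists (2 + M). intros v.
    pose proof (hnorm_nonneg v). pose proof (hnorm_P1 v). pose proof (hnorm_P2 v).
    apply sqr_le_le; [nra|]. rewrite dsnorm_two_sqr.
    pose proof (hnorm_add (P1 v) (L (P2 v))). pose proof (hM (P2 v)).
    pose proof (hnorm_nonneg (P1 v +' L (P2 v))). pose proof (hnorm_nonneg (P2 v)).
    assert (hnorm (P1 v +' L (P2 v)) <= (1 + M) * hnorm v) by nra.
    assert (hnorm (P1 v +' L (P2 v)) ^ 2 <= ((1 + M) * hnorm v) ^ 2) by (apply pow_incr; lra).
    assert (hnorm (P2 v) ^ 2 <= hnorm v ^ 2) by (apply pow_incr; lra). nra.
  - intros w hw. exists (J1 (w 0%nat -' L (w 1%nat)) +' J2 (w 1%nat)).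
    rewrite P1_J, P2_J. rewrite (two_eq w) at 5 by apply hw.
    f_equal. vring.
  - exists (2 + M). intros v.
    set (D := dsnorm _).
    assert (d0 : 0 <= D) by apply sqrt_pos.
    assert (e : D ^ 2 = hnorm (P1 v +' L (P2 v)) ^ 2 + hnorm (P2 v) ^ 2) by apply dsnorm_two_sqr.
    pose proof (hnorm_nonneg (P1 v +' L (P2 v))) as n1. pose proof (hnorm_nonneg (P2 v)) as n2.
    assert (hnorm (P1 v +' L (P2 v)) <= D) by (apply sqr_le_le; nra).
    assert (hnorm (P2 v) <= D) by (apply sqr_le_le; nra).
    assert (hnorm (P1 v) <= D + M * D).
    { replace (P1 v) with ((P1 v +' L (P2 v)) -' L (P2 v)) by vring.
      eapply Rle_trans; [apply hnorm_sub|]. pose proof (hM (P2 v)). nra. }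
    rewrite <- (J_P _ hv v). eapply Rle_trans; [apply hnorm_add|].
    rewrite hnorm_J1, hnorm_J2. lra.
Qed.

End Halves.

Lemma hs_scal_zero_r {H : HilbertSpace} a : a *' (0' : H) = 0'.
Proof. vring. Qed.

(** * Intertwinings and upper triangular tuples *)

Section Intertwining.
Context {H : HilbertSpace} {d r : nat} (hv : halves H)
  (Om : @tuple H d -> Prop) (Ok : nat -> @tuple H d -> Prop)
  (Hex : nc_exhaustion Om Ok) (HOm : forall x, Om x -> is_BHd x)
  (f : @tuple H d -> @tuple H r) (Hf : forall x, Om x -> is_BHd (f x))
  (Hnc : nc_function Om f).
Local Notation P1 := (hP1 hv).
Local Notation P2 := (hP2 hv).
Local Notation J1 := (hJ1 hv).
Local Notation J2 := (hJ2 hv).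

Lemma Ok_Om k x : Ok k x -> Om x.
Proof. intros h. apply Hex. exists k; exact h. Qed.

Lemma Ok_BHd k x : Ok k x -> is_BHd x.
Proof. intros h. eapply HOm, Ok_Om, h. Qed.

Lemma Ok_succ k x : Ok k x -> Ok (S k) x.
Proof.
  intros h. destruct (proj1 Hex k x h) as [e [he hi]]. apply hi; [eapply Ok_BHd, h|].
  eapply Rle_lt_trans; [|exact he]. apply tnorm_le; [lra|]. intros i v. unfold tsub.
  rewrite hnorm_sub_self. lra.
Qed.

Lemma Ok_le k l x : (k <= l)%nat -> Ok k x -> Ok l x.
Proof. intros h hx. induction h; [exact hx | apply Ok_succ; assumption]. Qed.

Definition dirsum (x y : @tuple H d) : @tuple H d := fun i v => J1 (x i (P1 v)) +' J2 (y i (P2 v)).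

(** The axiom on direct sums gives membership for some splitting [h'] only; the unitary that carries
    [hv] to [h'] and unitary invariance move it to the fixed splitting. *)
Lemma Ok_dirsum k x y : Ok k x -> Ok k y -> Ok k (dirsum x y).
Proof.
  intros hx hy. destruct Hex as [_ [_ [_ [hinv hsum]]]].
  destruct (hsum k (Some 2%nat) (fun n => match n with 0%nat => x | _ => y end)) as
    [u [hu [z [hz hc]]]]; [simpl; lia | intros [|[|n]]; auto; discriminate |].
  destruct (exists_halves u hu) as [h' eu].
  assert (c1 : forall i v, hP1 h' (z i v) = x i (hP1 h' v)).
  { intros i v. specialize (hc i v). rewrite !eu in hc. exact (f_equal (fun w => w 0%nat) hc). }
  assert (c2 : forall i v, hP2 h' (z i v) = y i (hP2 h' v)).
  { intros i v. specialize (hc i v). rewrite !eu in hc. exact (f_equal (fun w => w 1%nat) hc). }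
  apply (hinv k z (fun v => hJ1 h' (P1 v) +' hJ2 h' (P2 v))); [exact hz | |].
  - split; [|split].
    + apply BH_lin, BH_add; apply (BH_comp _ _); auto using BH_J1, BH_J2, BH_P1, BH_P2.
    + intros w. exists (J1 (hP1 h' w) +' J2 (hP2 h' w)). rewrite P1_J, P2_J. apply J_P.
    + intros v. apply sqr_eq_eq; try apply hnorm_nonneg.
      rewrite hnorm_J_sqr. symmetry; apply halves_norm.
  - intros i v. unfold dirsum. rewrite P1_J, P2_J.
    apply (halves_ext h'); rewrite ?P1_J, ?P2_J, ?c1, ?c2, ?P1_J, ?P2_J; reflexivity.
Qed.

(* If [u* (x (+) y) u] lies in the domain then so does its conjugate by [(1 L; 0 1) u], which is the
   same tuple because [x L = L y]; comparing the two formulas for [f] gives the claim. *)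
Lemma intertwine x y (L : H -> H) : Om x -> Om y -> is_BH L ->
  (forall i v, x i (L v) = L (y i v)) -> forall i v, f x i (L v) = L (f y i v).
Proof.
  intros hx hy hL hi i v.
  (* The direct sum axiom concerns points of one exhausting set, so [x] and [y] are put in a common
     one. *)
  assert (hk : exists k, Ok k x /\ Ok k y).
  { destruct (proj1 (proj1 (proj2 Hex) x) hx) as [k1 h1].
    destruct (proj1 (proj1 (proj2 Hex) y) hy) as [k2 h2].
    exists (k1 + k2)%nat. split; [apply (Ok_le k1) | apply (Ok_le k2)]; auto; lia. }
  destruct hk as [k [kx ky]].
  pose proof (Ok_Om k _ (Ok_dirsum k x y kx ky)) as hw.
  assert (lx : forall j, is_linear (x j)) by (intros; apply BH_lin, HOm, hx).
  pose proof (BH_lin _ hL) as lL.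
  pose proof (P2_lin _ hv) as l2.
  assert (BH0 : is_BH (fun _ : H => 0')) by apply BH_zero.
  pose proof (Hnc x y hx hy _ (bounded_invertible_shear hv (fun _ => 0') BH0) (dirsum x y) hw) as e0.
  pose proof (Hnc x y hx hy _ (bounded_invertible_shear hv L hL) (dirsum x y) hw) as e1.
  assert (c0 : conj_DS (fun v => two (P1 v +' 0') (P2 v)) (diag2 x y) (dirsum x y)).
  { intros j a. unfold dirsum, diag2, dsum. extensionality n.
    destruct n as [|[|n]]; simpl; rewrite ?P1_J, ?P2_J, ?hs_add_zero; reflexivity. }
  assert (c1 : conj_DS (fun v => two (P1 v +' L (P2 v)) (P2 v)) (diag2 x y) (dirsum x y)).
  { intros j a. unfold dirsum, diag2, dsum. extensionality n.
    destruct n as [|[|n]]; simpl; rewrite ?P1_J, ?P2_J, ?(lin_add (x j)), ?hi by apply lx;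
      reflexivity. }
  (* At [J2 v] the case [L = 0] says that [f (dirsum x y)] has coordinates 0 and [f(y) v]. The shear
     by [L] sends [J2 v] to [(L v, v)], and the first coordinate of [e1] is then the claim. *)
  specialize (e0 c0 i (J2 v)). specialize (e1 c1 i (J2 v)).
  pose proof (f_equal (fun w => w 0%nat) e0) as a0. pose proof (f_equal (fun w => w 1%nat) e0) as a1.
  pose proof (f_equal (fun w => w 0%nat) e1) as b0.
  unfold diag2, dsum in a0, a1, b0. simpl in a0, a1, b0.
  rewrite P1_J2, P2_J2 in *. rewrite !hs_add_zero in a0. rewrite hs_add_zero_l in b0.
  rewrite a0, a1, lin_zero, hs_add_zero_l in b0 by (apply BH_lin, Hf, hx).
  symmetry; exact b0.
Qed.

(** The block tuple [(x h; 0 y)], moved to [H] along [hv]. *)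
Definition block (x y h : @tuple H d) : @tuple H d :=
  fun i v => J1 (x i (P1 v) +' h i (P2 v)) +' J2 (y i (P2 v)).

Lemma BHd_block x y h : is_BHd x -> is_BHd y -> is_BHd h -> is_BHd (block x y h).
Proof.
  intros hx hy hh i. unfold block.
  pose proof (BH_P1 hv). pose proof (BH_P2 hv). pose proof (BH_J1 hv). pose proof (BH_J2 hv).
  apply BH_add.
  - apply (BH_comp J1 (fun v => x i (P1 v) +' h i (P2 v))); auto.
    apply BH_add; apply BH_comp; auto.
  - apply (BH_comp J2 (fun v => y i (P2 v))); auto. apply BH_comp; auto.
Qed.

(** Clause (ii) of a strong NC domain at one level, with [e] explicit because one [e] has to serve
    at two consecutive levels. *)
Definition radius (k : nat) (e : R) : Prop :=
  0 < e /\ forall x, is_BHd x -> (exists y, Ok k y /\ tnorm (tsub x y) < e) -> Ok (S k) x.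

Lemma radius_le k e e' : 0 < e' -> e' <= e -> radius k e -> radius k e'.
Proof.
  intros h0 h [_ hr]. split; [exact h0|]. intros x hx [y [hy hd]].
  apply hr; [exact hx|]. exists y. split; [exact hy | lra].
Qed.

(** [(x h; 0 y)] lies within [tnorm h] of the direct sum of [x] and [y]; the passage to the
    neighbourhood costs one level. *)
Lemma Ok_block k e x y h : radius k e -> Ok k x -> Ok k y -> is_BHd h -> tnorm h < e ->
  Ok (S k) (block x y h).
Proof.
  intros [_ hr] hx hy hh he.
  apply hr; [apply BHd_block; eauto using Ok_BHd|].
  exists (dirsum x y). split; [apply Ok_dirsum; assumption|].
  eapply Rle_lt_trans; [|exact he]. apply tnorm_le; [apply tnorm_nonneg, hh|].
  intros i v. unfold tsub, block, dirsum.
  rewrite (lin_add J1) by apply J1_lin.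
  replace (_ -' _) with (J1 (h i (P2 v))) by vring.
  rewrite hnorm_J1. eapply Rle_trans; [apply tnorm_bound, hh|].
  apply Rmult_le_compat_l; [apply tnorm_nonneg, hh | apply hnorm_P2].
Qed.

(* The off-diagonal corner of [f (x h; 0 y)]. *)
Definition delta (x y h : @tuple H d) : @tuple H r := fun i v => P1 (f (block x y h) i (J2 v)).

Ltac lin_push := repeat first
  [ rewrite P1_J | rewrite P2_J | rewrite P1_J1 | rewrite P1_J2 | rewrite P2_J1 | rewrite P2_J2
  | match goal with
    | hl : is_linear ?T |- context [?T (hs_add _ ?a ?b)] => rewrite (lin_add T a b hl)
    | hl : is_linear ?T |- context [?T (vsub ?a ?b)] => rewrite (lin_sub T a b hl)
    | hl : is_linear ?T |- context [?T (hs_scal _ ?a ?b)] => rewrite (lin_scal T a b hl)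
    | hl : is_linear ?T |- context [?T (hs_zero _)] => rewrite (lin_zero T hl)
    | hl : forall j, is_linear (?T j) |- context [?T ?j (hs_add _ ?a ?b)] =>
        rewrite (lin_add (T j) a b (hl j))
    | hl : forall j, is_linear (?T j) |- context [?T ?j (vsub ?a ?b)] =>
        rewrite (lin_sub (T j) a b (hl j))
    | hl : forall j, is_linear (?T j) |- context [?T ?j (hs_scal _ ?a ?b)] =>
        rewrite (lin_scal (T j) a b (hl j))
    | hl : forall j, is_linear (?T j) |- context [?T ?j (hs_zero _)] =>
        rewrite (lin_zero (T j) (hl j))
    end ].

Lemma BHd_lin n (x : @tuple H n) : is_BHd x -> forall i, is_linear (x i).
Proof. intros h i. apply BH_lin, h. Qed.

Let lP1 := P1_lin _ hv.
Let lP2 := P2_lin _ hv.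
Let lJ1 := J1_lin _ hv.
Let lJ2 := J2_lin _ hv.

(** [J1] intertwines [(x h; 0 y)] with [x]. This is the upper triangularity of the image, with
    [f(x)] as its upper left entry. *)
Lemma f_block_J1 x y h : Om x -> Om (block x y h) -> is_BHd y -> is_BHd h ->
  forall i v, f (block x y h) i (J1 v) = J1 (f x i v).
Proof.
  intros hx hw hy hh. apply intertwine; auto using BH_J1.
  pose proof (BHd_lin _ _ hy). pose proof (BHd_lin _ _ hh). intros i v. unfold block. lin_push. vring.
Qed.

(** [diag(a, 1)] intertwines [(x ah; 0 y)] with [(x h; 0 y)]. An intertwiner may be singular, so
    [a = 0] is included. *)
Lemma delta_scal a x y h : Om x -> Om y -> is_BHd h ->
  Om (block x y h) -> Om (block x y (tscal a h)) ->
  delta x y (tscal a h) = tscal a (delta x y h).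
Proof.
  intros hx hy hh h1 h2. apply tuple_ext. intros i v.
  pose proof (intertwine (block x y (tscal a h)) (block x y h)
    (fun v => J1 (a *' P1 v) +' J2 (P2 v)) h2 h1) as e.
  pose proof (BHd_lin _ _ (HOm _ hx)). pose proof (BHd_lin _ _ (HOm _ hy)).
  pose proof (BHd_lin _ _ hh).
  assert (e' : f (block x y (tscal a h)) i (J1 (a *' P1 (J2 v)) +' J2 (P2 (J2 v))) =
    J1 (a *' P1 (f (block x y h) i (J2 v))) +' J2 (P2 (f (block x y h) i (J2 v)))).
  { apply e.
    - apply BH_add; [|apply BH_comp; auto using BH_J2, BH_P2].
      apply (BH_comp J1 (fun v => a *' P1 v)); [apply BH_J1 | apply BH_scal, BH_P1].
    - intros j w. unfold block, tscal. lin_push. vring. }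
  apply (f_equal P1) in e'. rewrite P1_J in e'.
  rewrite P1_J2, P2_J2, hs_scal_zero_r, lin_zero, hs_add_zero_l in e' by apply lJ1. exact e'.
Qed.

(* Additivity comes from the three block tuples with corners [h1], [h2] and [h1 + h2] inside
   [Z = (x h1 h2; 0 x 0; 0 0 x)], here written as a 2 by 2 block with upper left corner [block x x h1]. *)
Lemma delta_add x h1 h2 : Om x -> is_BHd h1 -> is_BHd h2 ->
  Om (block x x h1) -> Om (block x x h2) -> Om (block x x (tadd h1 h2)) ->
  Om (block (block x x h1) x (fun i v => J1 (h2 i v))) ->
  delta x x (tadd h1 h2) = tadd (delta x x h1) (delta x x h2).
Proof.
  intros hx hh1 hh2 o1 o2 o12 oZ. apply tuple_ext. intros i v.
  pose proof (BHd_lin _ _ (HOm _ hx)). pose proof (BHd_lin _ _ hh1). pose proof (BHd_lin _ _ hh2).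
  pose proof (BH_P1 hv). pose proof (BH_P2 hv). pose proof (BH_J1 hv). pose proof (BH_J2 hv).
  set (Z := block (block x x h1) x (fun i v => J1 (h2 i v))) in *.
  (* In the three coordinates of [Z], the intertwiners behind [e1], [e2], [e3] send [(a, b)] to
     [(a, b, 0)], [(a, 0, b)] and [(a, b, b)]. For [a = 0] the third is the sum of the other two,
     and the top coordinate of [f(Z)] gives additivity. *)
  assert (e1 : f Z i (J1 (J2 v)) = J1 (f (block x x h1) i (J2 v))).
  { apply f_block_J1; auto. intros j. apply BH_comp; auto. }
  assert (e2 : f Z i (J1 (J1 (P1 (J2 v))) +' J2 (P2 (J2 v))) =
    J1 (J1 (P1 (f (block x x h2) i (J2 v)))) +' J2 (P2 (f (block x x h2) i (J2 v)))).
  { apply (intertwine Z (block x x h2) (fun w => J1 (J1 (P1 w)) +' J2 (P2 w)) oZ o2).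
    - apply BH_add; [|apply BH_comp; auto].
      apply (BH_comp J1 (fun w => J1 (P1 w))); auto. apply BH_comp; auto.
    - intros j w. unfold Z, block. lin_push. vring. }
  assert (e3 : f Z i (J1 (J2 v) +' J2 (P2 (J2 v))) =
    J1 (f (block x x (tadd h1 h2)) i (J2 v)) +' J2 (P2 (f (block x x (tadd h1 h2)) i (J2 v)))).
  { apply (intertwine Z (block x x (tadd h1 h2)) (fun w => J1 w +' J2 (P2 w)) oZ o12).
    - apply BH_add; auto. apply BH_comp; auto.
    - intros j w. unfold Z, block, tadd. lin_push. vring. }
  pose proof (BHd_lin _ _ (Hf _ oZ)) as lZ.
  rewrite (lin_add _ _ _ (lZ i)) in e2. rewrite (lin_add _ _ _ (lZ i)) in e3.
  rewrite P1_J2, !lin_zero, hs_add_zero_l in e2 by (apply lZ || apply lJ1).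
  rewrite e1, e2 in e3. apply (f_equal (fun w => P1 (P1 w))) in e3.
  revert e3. lin_push. intros e3.
  unfold delta at 1. rewrite <- e3. reflexivity.
Qed.

(** The column [(-a; 1)] intertwines [(x a(x-y); 0 y)] with [y]. Increments of [f] thereby become
    corners, which is the source of the Lipschitz and derivative estimates. *)
Lemma delta_diff a x y : Om x -> Om y -> Om (block x y (tscal a (tsub x y))) ->
  delta x y (tscal a (tsub x y)) = tscal a (tsub (f x) (f y)).
Proof.
  intros hx hy o. apply tuple_ext. intros i v.
  pose proof (BHd_lin _ _ (HOm _ hx)). pose proof (BHd_lin _ _ (HOm _ hy)).
  set (W := block x y (tscal a (tsub x y))) in *.
  assert (e : f W i (J2 v -' J1 (a *' v)) = J2 (f y i v) -' J1 (a *' f y i v)).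
  { apply (intertwine W y (fun w => J2 w -' J1 (a *' w)) o hy).
    - apply BH_sub; [apply BH_J2|]. apply BH_comp; [apply BH_J1 | apply BH_scal, BH_id].
    - intros j w. unfold W, block, tscal, tsub. lin_push. vring. }
  pose proof (BHd_lin _ _ (Hf _ o)) as lW. pose proof (BHd_lin _ _ (Hf _ hx)) as lx.
  rewrite (lin_sub _ _ _ (lW i)) in e. unfold W in e.
  rewrite f_block_J1, (lin_scal _ _ _ (lx i)) in e;
    auto using BHd_tscal, BHd_tsub.
  apply (f_equal P1) in e. revert e. lin_push. intros e.
  unfold delta, tscal, tsub in *.
  replace (P1 _) with ((P1 (f (block x y (fun i v => a *' (x i v -' y i v))) i (J2 v)) -' a *' f x i v)
    +' a *' f x i v) by vring.
  rewrite e. vring.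
Qed.

(** The intertwiner is [V] acting on both halves. For unitary [V] this lets [delta] follow a change
    of basis. *)
Lemma delta_conj x y h x' y' h' (V : H -> H) : is_BH V ->
  Om (block x y h) -> Om (block x' y' h') -> is_BHd x -> is_BHd h ->
  (forall i v, x i (V v) = V (x' i v)) -> (forall i v, y i (V v) = V (y' i v)) ->
  (forall i v, h i (V v) = V (h' i v)) ->
  forall i v, delta x y h i (V v) = V (delta x' y' h' i v).
Proof.
  intros hV o o' hx hh ex ey eh i v.
  pose proof (BHd_lin _ _ hx). pose proof (BHd_lin _ _ hh). pose proof (BH_lin _ hV).
  pose proof (BH_P1 hv). pose proof (BH_P2 hv). pose proof (BH_J1 hv). pose proof (BH_J2 hv).
  assert (e : f (block x y h) i (J1 (V (P1 (J2 v))) +' J2 (V (P2 (J2 v)))) =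
    J1 (V (P1 (f (block x' y' h') i (J2 v)))) +' J2 (V (P2 (f (block x' y' h') i (J2 v))))).
  { apply (intertwine _ _ (fun w => J1 (V (P1 w)) +' J2 (V (P2 w))) o o').
    - apply BH_add.
      + apply (BH_comp J1 (fun w => V (P1 w))); auto. apply BH_comp; auto.
      + apply (BH_comp J2 (fun w => V (P2 w))); auto. apply BH_comp; auto.
    - intros j w. unfold block. lin_push. rewrite ex, ey, eh. reflexivity. }
  apply (f_equal P1) in e. revert e. lin_push. rewrite hs_add_zero_l. auto.
Qed.

(* An infinite direct sum of tuples of [Ok k] stays in [Ok k], so its image is bounded. *)
Lemma f_bounded k : exists M, 0 <= M /\ forall x, Ok k x -> tuple_bounded_by (f x) M.
Proof.
  apply NNPP; intros n.
  assert (ex : forall N : nat, exists x, Ok k x /\ ~ tuple_bounded_by (f x) (INR N)).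
  { intros N. apply NNPP; intros c. apply n. exists (INR N). split; [apply pos_INR|].
    intros x hx. apply NNPP. intros c'. apply c. exists x; auto. }
  apply choice_fun in ex. destruct ex as [xs hxs].
  destruct Hex as [_ [_ [_ [_ hsum]]]].
  destruct (hsum k None xs I) as [u [hu [y [hy hc]]]]; [intros m _; apply hxs|].
  pose proof (Hf y (Ok_Om k y hy)) as fy.
  destruct (INR_unbounded (tnorm (f y))) as [N hN].
  apply (proj2 (hxs N)). intros i v.
  destruct (unitary_DS_embedding None u N hu eq_refl) as [J [lJ [nJ eJ]]].
  (* [J] intertwines the direct sum with its [N]-th summand, so [f (xs N)] is bounded by the norm of
     [f y], which is less than [N]. *)
  assert (e : f y i (J v) = J (f (xs N) i v)).
  { apply intertwine.
    - apply (Ok_Om k), hy.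
    - apply (Ok_Om k), hxs.
    - split; [exact lJ|]. exists 1. intros. rewrite nJ. lra.
    - intros j w. apply (unitary_DS_inj _ u _ _ hu). rewrite hc, !eJ.
      unfold dsum, single. extensionality m. simpl.
      destruct (Nat.eqb_spec m N) as [->|ne]; [reflexivity|].
      apply lin_zero, BH_lin, (Ok_BHd k), hxs. }
  rewrite <- nJ, <- e.
  eapply Rle_trans; [apply (tnorm_bound _ fy)|]. rewrite nJ.
  apply Rmult_le_compat_r; [apply hnorm_nonneg | lra].
Qed.

(** * Lipschitz bounds *)

Context (Hrad : forall k, exists e, radius k e).

Lemma delta_bounded k e : radius k e -> exists M, 0 <= M /\ forall x y h,
  Ok k x -> Ok k y -> is_BHd h -> tnorm h < e -> tuple_bounded_by (delta x y h) M.
Proof.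
  intros he. destruct (f_bounded (S k)) as [M [m0 hM]]. exists M. split; [exact m0|].
  intros x y h hx hy hh hn i v. unfold delta.
  eapply Rle_trans; [apply hnorm_P1|]. rewrite <- (hnorm_J2 hv v).
  apply hM. eapply Ok_block; eauto.
Qed.

Lemma tnorm_RC_le {n} t (h : @tuple H n) : 0 < t -> is_BHd h ->
  tnorm (tscal (RC t) h) <= t * tnorm h.
Proof.
  intros ht hh. rewrite <- (Rabs_right t) at 2 by lra. rewrite <- Cmod_RC.
  apply tnorm_tscal_le, hh.
Qed.

(** Rescale [x - y] by [t] to norm [e / 2]. By [delta_diff] the corner is then [t (f(x) - f(y))],
    bounded by [M]; the constant is [M] over [e / 2]. A zero difference cannot be rescaled and is
    treated apart. *)
Lemma f_lipschitz k : exists C, 0 <= C /\ forall x y, Ok k x -> Ok k y ->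
  tuple_bounded_by (tsub (f x) (f y)) (C * tnorm (tsub x y)).
Proof.
  destruct (Hrad k) as [e he]. pose proof (proj1 he) as e0.
  destruct (delta_bounded k e he) as [M [m0 hM]].
  exists (2 * M / e). split.
  { apply Rmult_le_pos; [lra | left; apply Rinv_0_lt_compat, e0]. }
  intros x y hx hy i v.
  assert (hh : is_BHd (tsub x y)) by (apply BHd_tsub; eapply Ok_BHd; eassumption).
  destruct (Rle_lt_dec (tnorm (tsub x y)) 0) as [n|n].
  - apply tnorm_eq0 in n as z; [|exact hh].
    assert (x = y).
    { apply tuple_ext. intros j w. apply vsub_eq0. exact (f_equal (fun t => t j w) z). }
    subst y. unfold tsub at 1. rewrite hnorm_sub_self.
    pose proof (tnorm_nonneg _ hh). replace (tnorm _) with 0 by lra. lra.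
  - set (N := tnorm (tsub x y)) in *. set (t := e / (2 * N)).
    assert (t0 : 0 < t) by (apply Rdiv_lt_0_compat; lra).
    assert (hn : tnorm (tscal (RC t) (tsub x y)) < e).
    { eapply Rle_lt_trans; [apply tnorm_RC_le; assumption|].
      change (t * N < e). replace (t * N) with (e / 2) by (unfold t; field; lra). lra. }
    pose proof (BHd_tscal (RC t) _ hh) as hh'.
    pose proof (hM x y _ hx hy hh' hn i v) as b.
    rewrite delta_diff in b;
      [| eapply Ok_Om; eassumption .. | eapply Ok_Om, Ok_block; eassumption].
    unfold tscal in b. rewrite hnorm_RC, Rabs_right in b by lra.
    apply (Rmult_le_reg_l t); [exact t0|].
    eapply Rle_trans; [exact b|]. right. unfold t. field. lra.
Qed.

(** The two block tuples share the corner [h], so their difference is diagonal with norm at most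
    [B], and [f] is Lipschitz on the next level. *)
Lemma delta_lipschitz k e : radius k e -> exists C, 0 <= C /\ forall x1 y1 x2 y2 h B,
  Ok k x1 -> Ok k y1 -> Ok k x2 -> Ok k y2 -> is_BHd h -> tnorm h < e ->
  tnorm (tsub x1 x2) <= B -> tnorm (tsub y1 y2) <= B ->
  tuple_bounded_by (tsub (delta x1 y1 h) (delta x2 y2 h)) (C * B).
Proof.
  intros he. destruct (f_lipschitz (S k)) as [C [c0 hC]]. exists C. split; [exact c0|].
  intros x1 y1 x2 y2 h B k1 l1 k2 l2 hh hn hx hy i v.
  assert (b1 : is_BHd x1) by (eapply Ok_BHd; eassumption).
  assert (b2 : is_BHd x2) by (eapply Ok_BHd; eassumption).
  assert (b3 : is_BHd y1) by (eapply Ok_BHd; eassumption).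
  assert (b4 : is_BHd y2) by (eapply Ok_BHd; eassumption).
  assert (B0 : 0 <= B) by (apply Rle_trans with (2 := hx), tnorm_nonneg, BHd_tsub; assumption).
  unfold tsub at 1, delta. rewrite <- lin_sub by apply lP1.
  eapply Rle_trans; [apply hnorm_P1|]. rewrite <- (hnorm_J2 hv v).
  eapply Rle_trans.
  { apply (hC (block x1 y1 h) (block x2 y2 h)); eapply Ok_block; eassumption. }
  apply Rmult_le_compat_r; [apply hnorm_nonneg|].
  apply Rmult_le_compat_l; [exact c0|].
  apply tnorm_le; [exact B0|]. intros j w. unfold tsub, block.
  replace (_ -' _) with (J1 (tsub x1 x2 j (P1 w)) +' J2 (tsub y1 y2 j (P2 w))).
  - pose proof (tuple_bounded_by_tnorm _ _ (BHd_tsub _ _ b1 b2) hx j (P1 w)) as q1.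
    pose proof (tuple_bounded_by_tnorm _ _ (BHd_tsub _ _ b3 b4) hy j (P2 w)) as q2.
    pose proof (hnorm_nonneg w).
    apply sqr_le_le; [nra|]. rewrite hnorm_J_sqr, Rpow_mult_distr, (halves_norm _ hv w).
    apply (conj (hnorm_nonneg _)), (pow_incr _ _ 2) in q1, q2.
    rewrite Rpow_mult_distr in q1, q2. lra.
  - unfold tsub. lin_push. vring.
Qed.

(** [delta x x] is controlled on corners of norm below [e] only; this is its homogeneous extension
    to all [h]. The [1 +] keeps the denominator positive at [h = 0]. *)
Definition deriv (e : R) (x h : @tuple H d) : @tuple H r :=
  let c := e / (2 * (1 + tnorm h)) in tscal (RC (/ c)) (delta x x (tscal (RC c) h)).

Lemma tscal_tscal {n} a b (h : @tuple H n) : tscal a (tscal b h) = tscal (Cmul a b) h.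
Proof. apply tuple_ext; intros; apply hs_scal_assoc. Qed.

Lemma tscal_one {n} (h : @tuple H n) : tscal C1 h = h.
Proof. apply tuple_ext; intros; apply hs_scal_one. Qed.

Lemma RC_inv_l t : 0 < t -> Cmul (RC (/ t)) (RC t) = C1.
Proof. intros h. rewrite <- RC_mul, Rinv_l by lra. reflexivity. Qed.

Lemma small_scalar N e : 0 < e -> 0 <= N -> exists t, 0 < t /\ t * N < e.
Proof.
  intros e0 n0. exists (e / (2 * (1 + N))). split.
  - apply Rdiv_lt_0_compat; lra.
  - apply (Rmult_lt_reg_r (2 * (1 + N))); [lra|].
    replace (e / (2 * (1 + N)) * N * (2 * (1 + N))) with (e * N) by (field; lra). nra.
Qed.

(** * The Fréchet derivative at a point *)

Section Point.
Context (k : nat) (e : R) (x : @tuple H d) (he : radius k e) (hx : Ok k x).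

(** Homogeneity of [delta] with ratio [a / c]: the scale [c] chosen in [deriv] does not matter. *)
Lemma deriv_spec a h : is_BHd h -> tnorm (tscal a h) < e ->
  delta x x (tscal a h) = tscal a (deriv e x h).
Proof.
  intros hh hn. unfold deriv. set (c := e / _).
  pose proof (tnorm_nonneg h hh). pose proof (proj1 he) as e0.
  assert (c0 : 0 < c) by (apply Rdiv_lt_0_compat; lra).
  assert (hc : tnorm (tscal (RC c) h) < e).
  { eapply Rle_lt_trans; [apply tnorm_RC_le; assumption|].
    apply (Rmult_lt_reg_r (2 * (1 + tnorm h))); [lra|].
    unfold c. replace (e / _ * _ * _) with (e * tnorm h) by (field; lra). nra. }
  assert (eq : tscal a h = tscal (Cmul a (RC (/ c))) (tscal (RC c) h)).
  { rewrite tscal_tscal. f_equal. pose proof (RC_inv_l c c0) as q.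
    replace (Cmul (Cmul a (RC (/ c))) (RC c)) with (Cmul a (Cmul (RC (/ c)) (RC c))) by ring.
    rewrite q. ring. }
  rewrite eq at 1. rewrite delta_scal, tscal_tscal.
  - reflexivity.
  - eapply Ok_Om; eassumption.
  - eapply Ok_Om; eassumption.
  - apply BHd_tscal, hh.
  - eapply Ok_Om, Ok_block; eauto using BHd_tscal.
  - rewrite <- eq. eapply Ok_Om, Ok_block; eauto using BHd_tscal.
Qed.

Lemma BHd_delta y z h : Om y -> Om z -> Om (block y z h) -> is_BHd (delta y z h).
Proof.
  intros hy hz hw i. unfold delta.
  apply (BH_comp P1 (fun v => f (block y z h) i (J2 v))); [apply BH_P1|].
  apply BH_comp; [apply Hf, hw | apply BH_J2].
Qed.

Lemma BHd_deriv h : is_BHd h -> is_BHd (deriv e x h).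
Proof.
  intros hh. destruct (small_scalar (tnorm h) e) as [t [t0 ht]];
    [apply he | apply tnorm_nonneg, hh|].
  assert (hn : tnorm (tscal (RC t) h) < e)
    by (eapply Rle_lt_trans; [apply tnorm_RC_le; assumption | exact ht]).
  replace (deriv e x h) with (tscal (RC (/ t)) (delta x x (tscal (RC t) h))).
  - apply BHd_tscal, BHd_delta; [eapply Ok_Om; eassumption .. |].
    eapply Ok_Om, Ok_block; eauto using BHd_tscal.
  - rewrite deriv_spec by assumption. rewrite tscal_tscal, RC_inv_l by exact t0. apply tscal_one.
Qed.

(** Identities for [deriv] are checked on multiples small enough for [delta]; this removes the
    factor afterwards. *)
Lemma tscal_RC_inj t {n} (g h : @tuple H n) : 0 < t -> tscal (RC t) g = tscal (RC t) h -> g = h.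
Proof.
  intros t0 q. apply (f_equal (tscal (RC (/ t)))) in q.
  rewrite !tscal_tscal, RC_inv_l, !tscal_one in q by exact t0. exact q.
Qed.

Lemma deriv_scal a h : is_BHd h -> deriv e x (tscal a h) = tscal a (deriv e x h).
Proof.
  intros hh. pose proof (BHd_tscal a h hh) as hah.
  destruct (small_scalar (tnorm (tscal a h)) e) as [t [t0 ht]];
    [apply he | apply tnorm_nonneg, hah|].
  assert (hn : tnorm (tscal (RC t) (tscal a h)) < e)
    by (eapply Rle_lt_trans; [apply tnorm_RC_le; assumption | exact ht]).
  apply (tscal_RC_inj t); [exact t0|].
  rewrite <- deriv_spec by assumption. rewrite tscal_tscal in hn |- *.
  rewrite deriv_spec by assumption. symmetry; apply tscal_tscal.
Qed.

Context (he' : radius (S k) e).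

(** The 3 by 3 tuple of [delta_add] borders a block tuple that already lies one level up, hence the
    radius at [S k] as well. *)
Lemma deriv_add h1 h2 : is_BHd h1 -> is_BHd h2 ->
  deriv e x (tadd h1 h2) = tadd (deriv e x h1) (deriv e x h2).
Proof.
  intros hh1 hh2.
  pose proof (tnorm_nonneg h1 hh1). pose proof (tnorm_nonneg h2 hh2).
  destruct (small_scalar (tnorm h1 + tnorm h2) e) as [t [t0 ht]]; [apply he | lra |].
  assert (n1 : tnorm (tscal (RC t) h1) < e)
    by (eapply Rle_lt_trans; [apply tnorm_RC_le; assumption | nra]).
  assert (n2 : tnorm (tscal (RC t) h2) < e)
    by (eapply Rle_lt_trans; [apply tnorm_RC_le; assumption | nra]).
  assert (n12 : tnorm (tscal (RC t) (tadd h1 h2)) < e).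
  { eapply Rle_lt_trans; [apply tnorm_RC_le; auto using BHd_tadd|].
    pose proof (tnorm_tadd_le h1 h2 hh1 hh2). nra. }
  apply (tscal_RC_inj t); [exact t0|].
  rewrite <- deriv_spec by auto using BHd_tadd.
  assert (eq : forall n (g1 g2 : @tuple H n),
    tscal (RC t) (tadd g1 g2) = tadd (tscal (RC t) g1) (tscal (RC t) g2)).
  { intros. apply tuple_ext. intros. unfold tscal, tadd. vring. }
  rewrite eq in n12 |- *.
  assert (n3 : tnorm (fun i v => J1 (tscal (RC t) h2 i v)) < e).
  { eapply Rle_lt_trans; [|exact n2].
    apply tnorm_le; [apply tnorm_nonneg, BHd_tscal, hh2|].
    intros i v. rewrite hnorm_J1. apply tnorm_bound, BHd_tscal, hh2. }
  assert (b1 : Ok (S k) (block x x (tscal (RC t) h1)))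
    by (apply (Ok_block k e); auto using BHd_tscal).
  rewrite delta_add, !deriv_spec, eq; auto using BHd_tscal.
  - eapply Ok_Om; eassumption.
  - eapply Ok_Om; eassumption.
  - eapply Ok_Om, (Ok_block k e); auto using BHd_tscal.
  - eapply Ok_Om, (Ok_block k e); auto using BHd_tscal, BHd_tadd.
  - eapply Ok_Om, (Ok_block (S k) e); auto; [apply Ok_succ, hx|].
    intros i. apply BH_comp; [apply BH_J1 | apply BHd_tscal, hh2].
Qed.

Lemma deriv_bounded : exists M, forall h, is_BHd h -> tnorm (deriv e x h) <= M * tnorm h.
Proof.
  pose proof (proj1 he) as e0.
  destruct (delta_bounded k e he) as [M [m0 hM]]. exists (2 * M / e). intros h hh.
  pose proof (tnorm_nonneg h hh).
  assert (q : 0 <= 2 * M / e) by (apply Rmult_le_pos; [lra | left; apply Rinv_0_lt_compat, e0]).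
  apply tnorm_le; [nra|]. intros i v.
  destruct (Rle_lt_dec (tnorm h) 0) as [n|n].
  - apply tnorm_eq0 in n as z; [|exact hh]. subst h.
    replace (@tzero H d) with (tscal C0 (@tzero H d)) at 1
      by (apply tuple_ext; intros; apply hs_scal_zero).
    rewrite deriv_scal by exact hh. unfold tscal. rewrite hs_scal_zero, hnorm_zero.
    apply Rmult_le_pos; [apply Rmult_le_pos; assumption | apply hnorm_nonneg].
  - set (t := e / (2 * tnorm h)).
    assert (t0 : 0 < t) by (apply Rdiv_lt_0_compat; lra).
    assert (hn : tnorm (tscal (RC t) h) < e).
    { eapply Rle_lt_trans; [apply tnorm_RC_le; assumption|].
      replace (t * tnorm h) with (e / 2) by (unfold t; field; lra). lra. }
    pose proof (hM x x _ hx hx (BHd_tscal (RC t) h hh) hn i v) as b.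
    rewrite deriv_spec in b by assumption.
    unfold tscal in b. rewrite hnorm_RC, Rabs_right in b by lra.
    apply (Rmult_le_reg_l t); [exact t0|].
    eapply Rle_trans; [exact b|]. right. unfold t. field. lra.
Qed.

(** With [y = x + h] and [t = e / (2|h|)], the increment of [f] times [t] is [delta y x (th)], and
    the derivative times [t] is [delta x x (th)]. They differ by at most [C|h|], so the remainder is
    at most [(2C/e)|h|^2]. *)
Lemma frechet_deriv_deriv : frechet_deriv Om f x (deriv e x).
Proof.
  split; [exact BHd_deriv|]. split; [exact deriv_add|]. split; [exact deriv_scal|].
  split; [exact deriv_bounded|]. intros eta eta0.
  pose proof (proj1 he) as e0.
  destruct (delta_lipschitz (S k) e he') as [C [c0 hC]].
  (* Below [e] the point [x + h] stays in [Ok (S k)]; below the second bound [(2C/e)|h|] is at most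
     [eta]. The [+ 1] allows [C = 0]. *)
  exists (Rmin e (eta * e / (2 * C + 1))).
  assert (q0 : 0 < eta * e / (2 * C + 1)) by (apply Rdiv_lt_0_compat; nra).
  split; [apply Rmin_glb_lt; assumption|].
  intros h hh hn _.
  pose proof (Rlt_le_trans _ _ _ hn (Rmin_l _ _)) as hn1.
  pose proof (Rlt_le_trans _ _ _ hn (Rmin_r _ _)) as hn2.
  pose proof (tnorm_nonneg h hh) as h0.
  assert (hxb : is_BHd x) by (eapply Ok_BHd; eassumption).
  assert (eh : tsub (tadd x h) x = h).
  { apply tuple_ext. intros. unfold tsub, tadd. vring. }
  set (y := tadd x h) in *.
  assert (hyb : is_BHd y) by (apply BHd_tadd; assumption).
  assert (ky : Ok (S k) y).
  { apply (proj2 he); [exact hyb|]. exists x. split; [exact hx|]. rewrite eh. exact hn1. }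
  pose proof (Ok_succ k x hx) as kx.
  apply tnorm_le; [nra|]. intros i v.
  destruct (Rle_lt_dec (tnorm h) 0) as [n|n].
  - apply tnorm_eq0 in n as z; [|exact hh].
    assert (exy : y = x).
    { apply tuple_ext. intros. unfold y. rewrite z. apply hs_add_zero. }
    assert (q : deriv e x h = tscal C0 (deriv e x h)).
    { rewrite <- deriv_scal by exact hh. f_equal. rewrite z.
      apply tuple_ext; intros; symmetry; apply hs_scal_zero. }
    unfold tsub. rewrite exy, q. unfold tscal. rewrite hs_scal_zero, hnorm_sub_zero, hnorm_sub_self.
    pose proof (hnorm_nonneg v). assert (0 <= eta * tnorm h) by nra. nra.
  - set (t := e / (2 * tnorm h)).
    assert (t0 : 0 < t) by (apply Rdiv_lt_0_compat; lra).
    assert (ht : tnorm (tscal (RC t) h) < e).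
    { eapply Rle_lt_trans; [apply tnorm_RC_le; assumption|].
      replace (t * tnorm h) with (e / 2) by (unfold t; field; lra). lra. }
    assert (b : hnorm (tsub (delta y x (tscal (RC t) h)) (delta x x (tscal (RC t) h)) i v) <=
      C * tnorm h * hnorm v).
    { apply hC; auto using BHd_tscal; [rewrite eh; lra|].
      apply tnorm_le; [exact h0|]. intros j w. unfold tsub. rewrite hnorm_sub_self.
      pose proof (hnorm_nonneg w). nra. }
    rewrite deriv_spec in b by assumption.
    assert (ed : delta y x (tscal (RC t) h) = tscal (RC t) (tsub (f y) (f x))).
    { rewrite <- eh at 1. apply delta_diff; [eapply Ok_Om; eassumption .. |].
      rewrite eh. eapply Ok_Om, Ok_block; eauto using BHd_tscal. }
    rewrite ed in b.
    replace (tsub _ _ i v) with (RC t *' tsub (tsub (f y) (f x)) (deriv e x h) i v) in b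
      by (unfold tsub, tscal; vring).
    rewrite hnorm_RC, Rabs_right in b by lra.
    apply (Rmult_le_reg_l t); [exact t0|].
    eapply Rle_trans; [exact b|]. rewrite <- !Rmult_assoc.
    apply Rmult_le_compat_r; [apply hnorm_nonneg|].
    replace (t * eta * tnorm h) with (e * eta / 2) by (unfold t; field; lra).
    apply (Rmult_lt_compat_r (2 * C + 1)) in hn2; [|lra].
    replace (eta * e / (2 * C + 1) * (2 * C + 1)) with (eta * e) in hn2 by (field; lra). nra.
Qed.

(** Derivatives are unique because the domain contains [x + th] for all small [t], so both
    expansions hold along that segment. *)
Lemma frechet_deriv_eq L h : frechet_deriv Om f x L -> is_BHd h -> L h = deriv e x h.
Proof.
  intros [Lb [_ [Ls [_ La]]]] hh. pose proof frechet_deriv_deriv as [_ [_ [_ [_ Da]]]].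
  apply tuple_ext. intros i v. apply hnorm_sub_eq. intros eta eta0.
  pose proof (tnorm_nonneg h hh) as h0. pose proof (hnorm_nonneg v) as v0.
  (* The two remainders at [th] together are at most [2 s t |h| |v|]; after division by [t], this
     choice of [s] leaves less than [eta]. *)
  destruct (small_scalar (2 * tnorm h * hnorm v) eta eta0) as [s [s0 hs]]; [nra|].
  destruct (La s s0) as [d1 [q1 b1]]. destruct (Da s s0) as [d2 [q2 b2]].
  destruct (small_scalar (tnorm h) (Rmin e (Rmin d1 d2))) as [t [t0 ht]]; [|exact h0|].
  { repeat apply Rmin_glb_lt; auto. apply he. }
  pose proof (Rmin_l e (Rmin d1 d2)). pose proof (Rmin_r e (Rmin d1 d2)).
  pose proof (Rmin_l d1 d2). pose proof (Rmin_r d1 d2).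
  pose proof (BHd_tscal (RC t) h hh) as hth.
  pose proof (tnorm_RC_le t h t0 hh) as hn.
  assert (hxb : is_BHd x) by (eapply Ok_BHd; eassumption).
  assert (o : Ok (S k) (tadd x (tscal (RC t) h))).
  { apply (proj2 he); [apply BHd_tadd; assumption|]. exists x. split; [exact hx|].
    replace (tsub _ _) with (tscal (RC t) h)
      by (apply tuple_ext; intros; unfold tsub, tadd; vring). lra. }
  pose proof (Ok_Om _ _ o) as oy. pose proof (Ok_Om _ _ hx) as ox.
  specialize (b1 _ hth ltac:(lra) oy). specialize (b2 _ hth ltac:(lra) oy).
  pose proof (tuple_bounded_by_tnorm _ _
    (BHd_tsub _ _ (BHd_tsub _ _ (Hf _ oy) (Hf _ ox)) (Lb _ hth)) b1 i v) as c1.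
  pose proof (tuple_bounded_by_tnorm _ _
    (BHd_tsub _ _ (BHd_tsub _ _ (Hf _ oy) (Hf _ ox)) (BHd_deriv _ hth)) b2 i v) as c2.
  rewrite Ls in c1 by exact hh. rewrite deriv_scal in c2 by exact hh.
  set (F := tsub (f (tadd x (tscal (RC t) h))) (f x)) in *.
  assert (c3 : t * hnorm (L h i v -' deriv e x h i v) <=
    2 * (s * tnorm (tscal (RC t) h) * hnorm v)).
  { rewrite <- (Rabs_right t) at 1 by lra. rewrite <- hnorm_RC.
    replace (RC t *' (L h i v -' deriv e x h i v)) with
      (tsub F (tscal (RC t) (deriv e x h)) i v -' tsub F (tscal (RC t) (L h)) i v)
      by (unfold tsub, tscal; vring).
    eapply Rle_trans; [apply hnorm_sub|]. lra. }
  apply (Rmult_le_reg_l t); [exact t0|].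
  eapply Rle_trans; [exact c3|].
  apply Rle_trans with (t * (s * (2 * tnorm h * hnorm v))); [|nra].
  assert (0 <= s * hnorm v) by nra. nra.
Qed.

End Point.

End Intertwining.

(** * Limits along an ultrafilter *)

(** A free ultrafilter: [ultra_ex] is properness and [ultra_tail] freeness. All bounded scalar
    sequences converge along it at once, which replaces diagonal extraction of subsequences. *)
Record ultra (U : (nat -> Prop) -> Prop) : Prop := {
  ultra_mono : forall A B : nat -> Prop, (forall n, A n -> B n) -> U A -> U B;
  ultra_and : forall A B : nat -> Prop, U A -> U B -> U (fun n => A n /\ B n);
  ultra_ex : forall A, U A -> exists n, A n;
  ultra_em : forall A, U A \/ U (fun n => ~ A n);
  ultra_tail : forall N, U (fun n => (N <= n)%nat)
}.

Lemma exists_ultra : exists U, ultra U.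
Proof.
  destruct (@filter.ultraFilterLemma nat filter.eventually _) as [U [hU hs]].
  exists U. pose proof hU as [[h0 [hT hI hS]] _]. split.
  - intros A B h hA. exact (hS A B h hA).
  - exact hI.
  - intros A hA. apply NNPP. intros n. apply h0.
    refine (hS A _ _ hA). intros m hm'. apply n. exists m; exact hm'.
  - intros A. exact (filter.in_ultra_setVsetC A hU).
  - intros N. apply hs. exists N; [exact Logic.I|].
    intros m h. simpl in h. exact (ssrbool.elimT ssrnat.leP h).
Qed.

Section UltraLimits.
Context {H : HilbertSpace} (U : (nat -> Prop) -> Prop) (hU : ultra U).

Lemma ultra_all (A : nat -> Prop) : (forall n, A n) -> U A.
Proof. intros h. apply (ultra_mono U hU (fun n => (0 <= n)%nat)); [auto | apply ultra_tail, hU]. Qed.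

Lemma ultra_and_imp (A B C : nat -> Prop) : U A -> U B -> (forall n, A n -> B n -> C n) -> U C.
Proof.
  intros hA hB h. apply (ultra_mono U hU (fun n => A n /\ B n)); [intros n []; auto|].
  apply ultra_and; assumption.
Qed.

Lemma ultra_Fin d (A : Fin.t d -> nat -> Prop) : (forall i, U (A i)) -> U (fun n => forall i, A i n).
Proof.
  induction d as [|d IH]; intros h.
  - apply ultra_all. intros n i. inversion i.
  - apply (ultra_and_imp _ _ _ (h Fin.F1) (IH (fun i => A (Fin.FS i)) (fun i => h (Fin.FS i)))).
    intros n h1 h2 i. pattern i. apply Fin.caseS'; auto.
Qed.

Lemma ultra_In {T} (l : list T) (A : T -> nat -> Prop) : (forall v, U (A v)) ->
  U (fun n => forall v, In v l -> A v n).
Proof.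
  intros h. induction l as [|v l IH].
  - apply ultra_all. intros n v [].
  - apply (ultra_and_imp _ _ _ (h v) IH). intros n h1 h2 w [<-|hw]; auto.
Qed.

Definition rlim (a : nat -> R) (l : R) : Prop := forall e, 0 < e -> U (fun n => Rabs (a n - l) < e).
Definition vlim (w : nat -> H) (l : H) : Prop := forall e, 0 < e -> U (fun n => hnorm (w n -' l) < e).

(** The limit is the supremum of the [t] with [t <= a n] for almost all [n]. That [l + e / 2] is no
    such [t] becomes a bound for almost all [n] through [ultra_em]. *)
Lemma rlim_exists a B : (forall n, Rabs (a n) <= B) -> exists l, rlim a l.
Proof.
  intros hB. set (E := fun t => U (fun n => t <= a n)).
  destruct (completeness E) as [l [h1 h2]].
  - exists B. intros t ht. destruct (ultra_ex U hU _ ht) as [n hn].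
    pose proof (hB n). pose proof (Rle_abs (a n)). lra.
  - exists (- B). apply ultra_all. intros n. pose proof (hB n) as b.
    apply Rabs_le_inv in b. lra.
  - exists l. intros e e0.
    assert (q1 : U (fun n => l - e < a n)).
    { apply NNPP. intros c. assert (l <= l - e); [|lra]. apply h2. intros t ht.
      apply Rnot_lt_le. intros lt. apply c. apply (ultra_mono U hU _ _ (fun n (hn : t <= a n) =>
        Rlt_le_trans _ _ _ lt hn) ht). }
    assert (q2 : U (fun n => ~ l + e / 2 <= a n)).
    { destruct (ultra_em U hU (fun n => l + e / 2 <= a n)) as [c|c]; [|exact c].
      assert (l + e / 2 <= l); [|lra]. apply h1. exact c. }
    apply (ultra_and_imp _ _ _ q1 q2). intros n c1 c2. apply Rabs_def1; lra.
Qed.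

Lemma vlim_const l : vlim (fun _ => l) l.
Proof. intros e e0. apply ultra_all. intros n. rewrite hnorm_sub_self. exact e0. Qed.

Lemma vlim_unique w l l' : vlim w l -> vlim w l' -> l = l'.
Proof.
  intros h h'. apply hnorm_sub_eq. intros e e0.
  destruct (ultra_ex U hU _ (ultra_and U hU _ _ (h (e / 2) ltac:(lra)) (h' (e / 2) ltac:(lra)))) as [n [c c']].
  rewrite hnorm_sub_sym in c. pose proof (hnorm_sub_triangle l (w n) l'). lra.
Qed.

Lemma vlim_add w w' l l' : vlim w l -> vlim w' l' -> vlim (fun n => w n +' w' n) (l +' l').
Proof.
  intros h h' e e0.
  apply (ultra_and_imp _ _ _ (h (e / 2) ltac:(lra)) (h' (e / 2) ltac:(lra))). intros n c c'.
  replace (_ -' _) with ((w n -' l) +' (w' n -' l')) by vring.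
  eapply Rle_lt_trans; [apply hnorm_add | lra].
Qed.

Lemma vlim_BH (T : H -> H) w l : is_BH T -> vlim w l -> vlim (fun n => T (w n)) (T l).
Proof.
  intros hT h e e0. destruct (BH_bound T hT) as [M [M0 hM]].
  assert (q : 0 < e / (M + 1)) by (apply Rdiv_lt_0_compat; lra).
  apply (ultra_mono U hU) with (2 := h _ q). intros n c.
  rewrite <- lin_sub by apply BH_lin, hT.
  eapply Rle_lt_trans; [apply hM|].
  pose proof (hnorm_nonneg (w n -' l)).
  apply (Rmult_lt_compat_l (M + 1)) in c; [|lra].
  replace ((M + 1) * (e / (M + 1))) with e in c by (field; lra). nra.
Qed.

Lemma vlim_norm_le w l B : vlim w l -> U (fun n => hnorm (w n) <= B) -> hnorm l <= B.
Proof.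
  intros h hB. apply le_epsilon. intros e e0.
  destruct (ultra_ex U hU _ (ultra_and U hU _ _ (h e e0) hB)) as [n [c c']].
  replace l with (w n -' (w n -' l)) by vring.
  eapply Rle_trans; [apply hnorm_sub | lra].
Qed.

Lemma vlim_squeeze w (a : nat -> R) : (forall n, hnorm (w n) <= a n) ->
  (forall e, 0 < e -> U (fun n => a n < e)) -> vlim w 0'.
Proof.
  intros h ha e e0. apply (ultra_mono U hU) with (2 := ha e e0). intros n c.
  rewrite hnorm_sub_zero. specialize (h n). lra.
Qed.

Lemma inv_INR_small e : 0 < e -> exists N, forall n, (N <= n)%nat -> / (INR n + 1) < e.
Proof.
  intros e0. destruct (INR_unbounded (/ e)) as [N hN]. exists N. intros n h.
  apply le_INR in h. pose proof (Rinv_0_lt_compat e e0).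
  rewrite <- (Rinv_inv e). apply Rinv_lt_contravar; [nra | lra].
Qed.

(** Completeness of [H] concerns ordinary sequences, so it is applied to centres [c m] that are
    within [1/(m+1)] of almost all [w n]; any two centres share such an [n]. *)
Lemma vlim_cauchy w : (forall e, 0 < e -> exists c, U (fun n => hnorm (w n -' c) < e)) ->
  exists l, vlim w l.
Proof.
  intros h.
  assert (h' : forall m : nat, exists c, U (fun n => hnorm (w n -' c) < / (INR m + 1))).
  { intros m. apply h, Rinv_0_lt_compat. pose proof (pos_INR m). lra. }
  apply choice_fun in h'. destruct h' as [c hc].
  assert (hd : forall m n, hnorm (c m -' c n) < / (INR m + 1) + / (INR n + 1)).
  { intros m n. destruct (ultra_ex U hU _ (ultra_and U hU _ _ (hc m) (hc n))) as [k [c1 c2]].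
    rewrite hnorm_sub_sym in c1. pose proof (hnorm_sub_triangle (c m) (w k) (c n)). lra. }
  destruct (hs_complete H c) as [l hl].
  - intros e e0. destruct (inv_INR_small (e / 2) ltac:(lra)) as [N hN]. exists N. intros m n hm hn.
    pose proof (hN m hm). pose proof (hN n hn).
    eapply Rlt_trans; [apply (hd m n) | lra].
  - exists l. intros e e0. destruct (inv_INR_small (e / 2) ltac:(lra)) as [N hN].
    destruct (hl (e / 2) ltac:(lra)) as [N' hN'].
    pose proof (hN (N + N')%nat ltac:(lia)) as q. pose proof (hN' (N + N')%nat ltac:(lia)) as q'.
    apply (ultra_mono U hU) with (2 := hc (N + N')%nat). intros n c'.
    change (hnorm (c (N + N')%nat -' l) < e / 2) in q'.
    pose proof (hnorm_sub_triangle (w n) (c (N + N')%nat) l). lra.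
Qed.

Lemma vlim_scal_exists (a : nat -> Cx) v B : 0 <= B ->
  (forall n, Rabs (Cre (a n)) <= B) -> (forall n, Rabs (Cim (a n)) <= B) ->
  exists l, vlim (fun n => a n *' v) l.
Proof.
  intros B0 h1 h2. destruct (rlim_exists _ _ h1) as [x hx]. destruct (rlim_exists _ _ h2) as [y hy].
  exists (mkCx x y *' v). intros e e0. pose proof (hnorm_nonneg v).
  assert (q : 0 < e / (2 * (hnorm v + 1))) by (apply Rdiv_lt_0_compat; lra).
  apply (ultra_and_imp _ _ _ (hx _ q) (hy _ q)). intros n c1 c2.
  replace (_ -' _) with (Csub (a n) (mkCx x y) *' v) by (unfold Csub; vring).
  rewrite hnorm_scal.
  set (m := Rmax (Rabs (Cre (a n) - x)) (Rabs (Cim (a n) - y))).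
  assert (c : Cmod (Csub (a n) (mkCx x y)) <= 2 * m).
  { apply Cmod_le; simpl; [apply Rmax_l | apply Rmax_r]. }
  assert (m < e / (2 * (hnorm v + 1))) as hm by (apply Rmax_lub_lt; assumption).
  apply (Rmult_lt_compat_r (2 * (hnorm v + 1))) in hm; [|lra].
  replace (e / (2 * (hnorm v + 1)) * (2 * (hnorm v + 1))) with e in hm by (field; lra).
  assert (0 <= m) by (eapply Rle_trans; [apply Rabs_pos | apply Rmax_l]). nra.
Qed.

(** The uniform bound carries convergence from a dense set of vectors to all vectors. *)
Lemma operator_limit (T : nat -> H -> H) M : 0 <= M ->
  (forall n, is_linear (T n)) -> (forall n, bounded_by (T n) M) ->
  (forall v e, 0 < e -> exists w, hnorm (v -' w) < e /\ exists l, vlim (fun n => T n w) l) ->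
  exists T', is_linear T' /\ bounded_by T' M /\ forall v, vlim (fun n => T n v) (T' v).
Proof.
  intros M0 hl hM hd.
  assert (ex : forall v, exists l, vlim (fun n => T n v) l).
  { intros v. apply vlim_cauchy. intros e e0.
    assert (q : 0 < e / (2 * (M + 1))) by (apply Rdiv_lt_0_compat; lra).
    destruct (hd v _ q) as [w [hw [l h]]]. exists l.
    apply (ultra_mono U hU) with (2 := h (e / 2) ltac:(lra)). intros n c.
    pose proof (hnorm_sub_triangle (T n v) (T n w) l) as t.
    rewrite <- lin_sub in t by apply hl. pose proof (hM n (v -' w)).
    pose proof (hnorm_nonneg (v -' w)).
    apply (Rmult_lt_compat_r (2 * (M + 1))) in hw; [|lra].
    replace (e / (2 * (M + 1)) * (2 * (M + 1))) with e in hw by (field; lra). nra. }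
  apply choice_fun in ex. destruct ex as [T' hT']. exists T'. split; [split|split; [|exact hT']].
  - intros u v. apply (vlim_unique (fun n => T n (u +' v))); [apply hT'|].
    replace (fun n => T n (u +' v)) with (fun n => T n u +' T n v)
      by (extensionality n; symmetry; apply lin_add, hl).
    apply vlim_add; apply hT'.
  - intros a v. apply (vlim_unique (fun n => T n (a *' v))); [apply hT'|].
    replace (fun n => T n (a *' v)) with (fun n => a *' T n v)
      by (extensionality n; symmetry; apply lin_scal, hl).
    apply (vlim_BH (fun w => a *' w)); [apply BH_scal, BH_id | apply hT'].
  - intros v. apply (vlim_norm_le (fun n => T n v)); [apply hT'|].
    apply ultra_all. intros n. apply hM.
Qed.

(** A basic strong neighbourhood tests finitely many coordinates on finitely many vectors, and [U]
    is stable under finite intersections. *)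
Lemma ultra_sot_nbhd {d} (x : nat -> @tuple H d) X : (forall i v, vlim (fun n => x n i v) (X i v)) ->
  forall vs e, 0 < e -> U (fun n => sot_nbhd X vs e (x n)).
Proof.
  intros h vs e e0. apply ultra_Fin. intros i. apply ultra_In. intros v. apply h, e0.
Qed.

Lemma sot_closed_limit {d} (A : @tuple H d -> Prop) (x : nat -> @tuple H d) X :
  sot_closed A -> (forall n, A (x n)) -> (forall n, is_BHd (x n)) -> is_BHd X ->
  (forall i v, vlim (fun n => x n i v) (X i v)) -> A X.
Proof.
  intros hA hx hb hX hl. apply NNPP. intros n. destruct (hA X hX n) as [vs [e [e0 h]]].
  destruct (ultra_ex U hU _ (ultra_sot_nbhd x X hl vs e e0)) as [m hm].
  exact (h (x m) (hb m) hm (hx m)).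
Qed.

Lemma sot_continuous_limit {d r} (A : @tuple H d -> Prop) (f : @tuple H d -> @tuple H r) x X :
  sot_continuous_on A f -> (forall n, A (x n)) -> A X ->
  (forall i v, vlim (fun n => x n i v) (X i v)) -> forall i v, vlim (fun n => f (x n) i v) (f X i v).
Proof.
  intros hf hx hX hl i v e e0. destruct (hf X hX (v :: nil) e e0) as [vs [dl [d0 h]]].
  apply (ultra_mono U hU) with (2 := ultra_sot_nbhd x X hl vs dl d0). intros n c.
  apply (h (x n) (hx n) c). left; reflexivity.
Qed.

End UltraLimits.

(** * Orthonormal bases *)

Section Bases.
Context {H : HilbertSpace}.
Implicit Types (b e : nat -> H) (u v w z : H).

Fixpoint comb (c : nat -> Cx) b (N : nat) : H :=
  match N with 0%nat => 0' | S n => comb c b n +' c n *' b n end.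

(** For orthonormal [b], the orthogonal projection onto the span of the first [N] vectors.
    Membership of [w] in that span is written [proj b N w = w]. *)
Definition proj b (N : nat) v : H := comb (fun j => <<v, b j>>) b N.

Definition orthonormal_below b (N : nat) : Prop :=
  forall i j, (i < N)%nat -> (j < N)%nat -> <<b i, b j>> = if Nat.eqb i j then C1 else C0.

Definition orthonormal b : Prop := forall N, orthonormal_below b N.

Definition total b : Prop := forall v eps, 0 < eps -> exists N, hnorm (v -' proj b N v) < eps.

Lemma orthonormal_below_le b M N : (M <= N)%nat -> orthonormal_below b N -> orthonormal_below b M.
Proof. intros h hb i j hi hj. apply hb; lia. Qed.

Lemma orthonormal_norm b j : orthonormal b -> hnorm (b j) = 1.
Proof.
  intros hb. apply sqr_eq_eq; [apply hnorm_nonneg | lra |].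
  rewrite hnorm_sqr. unfold ip. rewrite (hb (S j)), Nat.eqb_refl by lia. simpl. ring.
Qed.

Lemma comb_ext c c' b b' N : (forall j, (j < N)%nat -> c j = c' j) ->
  (forall j, (j < N)%nat -> b j = b' j) -> comb c b N = comb c' b' N.
Proof.
  intros h h'. induction N as [|N IH]; [reflexivity|]. simpl. rewrite IH, h, h'; auto.
Qed.

Lemma comb_map (T : H -> H) c b N : is_linear T -> T (comb c b N) = comb c (fun j => T (b j)) N.
Proof.
  intros hT. induction N as [|N IH]; simpl; [apply lin_zero, hT|].
  rewrite lin_add, lin_scal, IH by exact hT. reflexivity.
Qed.

Lemma comb_inner_orth c b N w : (forall j, (j < N)%nat -> <<b j, w>> = C0) -> <<comb c b N, w>> = C0.
Proof.
  intros h. induction N as [|N IH]; simpl; [apply inner_zero_l|].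
  rewrite hs_inner_addl, hs_inner_scall, IH, h by auto. ring.
Qed.

Lemma comb_inner c b N j : orthonormal_below b N -> (j < N)%nat -> <<comb c b N, b j>> = c j.
Proof.
  intros hb hj. revert hb. induction hj; intros hb; simpl; rewrite hs_inner_addl, hs_inner_scall.
  - rewrite comb_inner_orth; [rewrite hb, Nat.eqb_refl by lia; ring|].
    intros i hi. rewrite hb by lia. destruct (Nat.eqb_spec i j); [lia | reflexivity].
  - rewrite IHhj by (apply orthonormal_below_le with (2 := hb); lia).
    rewrite hb by lia. destruct (Nat.eqb_spec m j); [lia | ring].
Qed.

Lemma proj_inner b N v j : orthonormal_below b N -> (j < N)%nat -> <<proj b N v, b j>> = <<v, b j>>.
Proof. intros hb hj. apply comb_inner; assumption. Qed.

Lemma proj_lin b N : is_linear (proj b N).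
Proof.
  unfold proj. induction N as [|N [IHa IHs]]; split; intros; simpl.
  - vring.
  - vring.
  - rewrite IHa, hs_inner_addl. vring.
  - rewrite IHs, hs_inner_scall. vring.
Qed.

Lemma proj_basis b N j : orthonormal_below b N -> (j < N)%nat -> proj b N (b j) = b j.
Proof.
  intros hb hj. revert hb. induction hj; intros hb; unfold proj in *; simpl.
  - assert (e : forall M, (M <= j)%nat -> comb (fun i => <<b j, b i>>) b M = 0').
    { induction M as [|M IH]; intros hM; simpl; [reflexivity|].
      rewrite IH, hb by lia. destruct (Nat.eqb_spec j M); [lia | vring]. }
    rewrite e, hb, Nat.eqb_refl by lia. vring.
  - rewrite IHhj by (apply orthonormal_below_le with (2 := hb); lia).
    rewrite hb by lia. destruct (Nat.eqb_spec j m); [lia | vring].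
Qed.

Lemma proj_comb c b M N : orthonormal_below b N -> (M <= N)%nat ->
  proj b N (comb c b M) = comb c b M.
Proof.
  intros hb h. rewrite comb_map by apply proj_lin. apply comb_ext; [reflexivity|].
  intros j hj. apply proj_basis; [exact hb | lia].
Qed.

Lemma sub_proj_orth b N v j : orthonormal_below b N -> (j < N)%nat -> <<v -' proj b N v, b j>> = C0.
Proof. intros hb hj. rewrite inner_sub_l, proj_inner by assumption. ring. Qed.

Lemma inner_C0_sym u v : <<u, v>> = C0 -> <<v, u>> = C0.
Proof. intros h. rewrite hs_inner_conj, h. apply Cx_ext; simpl; ring. Qed.

Lemma sub_proj_norm b N v : orthonormal_below b N -> hnorm (v -' proj b N v) <= hnorm v.
Proof.
  intros hb. apply sqr_le_le; [apply hnorm_nonneg|].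
  set (z := v -' proj b N v).
  assert (e : ip (proj b N v) z = 0).
  { unfold ip, proj. rewrite comb_inner_orth; [reflexivity|].
    intros j hj. apply inner_C0_sym, sub_proj_orth; assumption. }
  replace (hnorm v) with (hnorm (z +' proj b N v)) by (f_equal; unfold z; vring).
  rewrite (hnorm_sqr (z +' _)), !ip_add_l, !ip_add_r, (ip_sym z (proj b N v)), e, <- hnorm_sqr.
  pose proof (ip_self_nonneg (proj b N v)). lra.
Qed.

(** As the projection fixes [w], the residual of [v] is also the residual of [v - w]. *)
Lemma proj_best b M N v w : orthonormal_below b N -> (M <= N)%nat -> proj b M w = w ->
  hnorm (v -' proj b N v) <= hnorm (v -' w).
Proof.
  intros hb h hw.
  assert (e : proj b N w = w) by (rewrite <- hw; apply proj_comb; assumption).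
  replace (v -' proj b N v) with ((v -' w) -' proj b N (v -' w)).
  - apply sub_proj_norm, hb.
  - rewrite lin_sub, e by apply proj_lin. vring.
Qed.

Lemma unit_vector u : u <> 0' -> exists t, 0 < t /\ <<RC t *' u, RC t *' u>> = C1 /\ t * hnorm u = 1.
Proof.
  intros h. assert (n : 0 < hnorm u).
  { apply Rnot_le_lt. intros c. apply h, hnorm_eq0, c. }
  exists (/ hnorm u). split; [apply Rinv_0_lt_compat, n|]. split; [|field; lra].
  destruct (normalize u n) as [e _]. apply Cx_ext.
  - pose proof (hnorm_sqr (RC (/ hnorm u) *' u)) as q. rewrite e in q. unfold ip in q.
    rewrite <- q. simpl. ring.
  - apply inner_self_im.
Qed.

(** One list [vs] has to work for all coefficients, since [infinite_dimensional] fixes the list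
    first. *)
Lemma comb_lincomb c b N : exists cs vs, comb c b N = lincomb cs vs /\
  forall c', exists cs', comb c' b N = lincomb cs' vs.
Proof.
  induction N as [|N [cs [vs [e h]]]].
  - exists nil, nil. split; [reflexivity|]. intros. exists nil; reflexivity.
  - exists (c N :: cs), (b N :: vs). split; [simpl; rewrite e; apply hs_add_comm|].
    intros c'. destruct (h c') as [cs' e']. exists (c' N :: cs'). simpl. rewrite e'. apply hs_add_comm.
Qed.

Lemma not_in_span (Hinf : @infinite_dimensional H) b N : exists v, v -' proj b N v <> 0'.
Proof.
  destruct (comb_lincomb (fun _ => C0) b N) as [_ [vs [_ h]]].
  destruct (Hinf vs) as [v hv]. exists v. intros e. apply vsub_eq0 in e.
  destruct (h (fun j => <<v, b j>>)) as [cs hcs]. apply (hv cs). rewrite e at 1. exact hcs.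
Qed.

(** A Gram-Schmidt step that always adds exactly one vector: if [w] is already in the span, a new
    direction comes from infinite dimension. This keeps the count of vectors independent of the
    data. *)
Lemma extend_orthonormal (Hinf : @infinite_dimensional H) b N w : orthonormal_below b N ->
  exists z, <<z, z>> = C1 /\ (forall j, (j < N)%nat -> <<z, b j>> = C0) /\
    w = proj b N w +' <<w, z>> *' z.
Proof.
  intros hb.
  assert (ex : exists v, v -' proj b N v <> 0' /\
    (w -' proj b N w = 0' \/ w -' proj b N w = v -' proj b N v)).
  { destruct (classic (w -' proj b N w = 0')) as [e|e].
    - destruct (not_in_span Hinf b N) as [v hv]. exists v; auto.
    - exists w; auto. }
  destruct ex as [v [hv hw]]. set (u := v -' proj b N v) in *.
  destruct (unit_vector u hv) as [t [t0 [ht hn]]]. exists (RC t *' u).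
  assert (orth : forall j, (j < N)%nat -> <<RC t *' u, b j>> = C0).
  { intros j hj. rewrite hs_inner_scall. unfold u. rewrite sub_proj_orth by assumption. ring. }
  split; [exact ht|]. split; [exact orth|].
  set (z := RC t *' u) in *.
  assert (q : <<proj b N w, z>> = C0).
  { apply comb_inner_orth. intros j hj. apply inner_C0_sym, orth, hj. }
  assert (e : w = proj b N w +' (w -' proj b N w)) by vring.
  assert (ez : <<w, z>> = <<w -' proj b N w, z>>) by (rewrite e at 1; rewrite hs_inner_addl, q; ring).
  rewrite ez. rewrite e at 1. f_equal. destruct hw as [hw|hw]; rewrite hw.
  - rewrite inner_zero_l. vring.
  - assert (eu : u = RC (hnorm u) *' z).
    { unfold z. rewrite hs_scal_assoc, <- RC_mul, Rmult_comm, hn. symmetry; apply hs_scal_one. }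
    rewrite eu at 2. rewrite hs_inner_scall, ht. rewrite eu at 1. f_equal. ring.
Qed.

(** Step [N] absorbs [F N b], which may depend on the vectors up to index [N]. Starting from [v0],
    there are [N + 2] vectors after that step. *)
Lemma exists_adapted_sequence (Hinf : @infinite_dimensional H) (F : nat -> (nat -> H) -> H) v0 :
  <<v0, v0>> = C1 ->
  (forall N s s', (forall j, (j <= N)%nat -> s j = s' j) -> F N s = F N s') ->
  exists b, orthonormal b /\ b 0%nat = v0 /\ forall N, proj b (S (S N)) (F N b) = F N b.
Proof.
  intros hv0 hF.
  assert (ex : forall p : nat * (nat -> H), exists z, orthonormal_below (snd p) (S (fst p)) ->
    <<z, z>> = C1 /\ (forall j, (j < S (fst p))%nat -> <<z, snd p j>> = C0) /\
    F (fst p) (snd p) = proj (snd p) (S (fst p)) (F (fst p) (snd p)) +' <<F (fst p) (snd p), z>> *' z).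
  { intros [N s]. simpl. destruct (classic (orthonormal_below s (S N))) as [h|h].
    - destruct (extend_orthonormal Hinf s (S N) (F N s) h) as [z hz]. exists z. auto.
    (* A dummy value; the sequences fed to [next] below turn out to be orthonormal. *)
    - exists 0'. intros c. contradiction. }
  apply choice_fun in ex. destruct ex as [next hnext].
  (* Only the entries of [S_ N] up to index [N] are final; [b] is the diagonal. *)
  pose (S_ := nat_rect (fun _ => nat -> H) (fun _ => v0)
    (fun N s j => if Nat.leb j N then s j else next (N, s))).
  pose (b := fun j => S_ j j).
  assert (hS : forall N j, (j <= N)%nat -> S_ N j = b j).
  { induction N as [|N IH]; intros j hj.
    - replace j with 0%nat by lia. reflexivity.
    - destruct (Nat.eq_dec j (S N)) as [->|ne]; [reflexivity|].
      simpl. destruct (Nat.leb_spec j N); [apply IH; lia | lia]. }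
  assert (hb1 : forall N, b (S N) = next (N, S_ N)).
  { intros N. change (b (S N)) with (if Nat.leb (S N) N then S_ N (S N) else next (N, S_ N)).
    destruct (Nat.leb_spec (S N) N); [lia | reflexivity]. }
  assert (hbs : forall N, orthonormal_below b (S N) -> orthonormal_below (S_ N) (S N)).
  { intros N h i j hi hj. rewrite !hS by lia. apply h; assumption. }
  assert (hb : forall N, orthonormal_below b (S N)).
  { induction N as [|N IH].
    - intros i j hi hj. replace i with 0%nat by lia. replace j with 0%nat by lia. exact hv0.
    - destruct (hnext (N, S_ N) (hbs N IH)) as [h1 [h2 _]]. simpl in h1, h2.
      rewrite <- hb1 in h1, h2.
      assert (h2' : forall j, (j < S N)%nat -> <<b (S N), b j>> = C0).
      { intros j hj. rewrite <- (hS N j) by lia. apply h2, hj. }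
      intros i j hi hj.
      destruct (Nat.eq_dec i (S N)) as [->|ni], (Nat.eq_dec j (S N)) as [->|nj].
      + rewrite Nat.eqb_refl. exact h1.
      + destruct (Nat.eqb_spec (S N) j); [lia|]. apply h2'; lia.
      + destruct (Nat.eqb_spec i (S N)); [lia|]. apply inner_C0_sym, h2'; lia.
      + apply IH; lia. }
  exists b. split; [|split; [reflexivity|]].
  - intros N. apply orthonormal_below_le with (2 := hb N). lia.
  - intros N. destruct (hnext (N, S_ N) (hbs N (hb N))) as [_ [_ h]]. simpl in h.
    rewrite <- hb1 in h.
    assert (eF : F N (S_ N) = F N b) by (apply hF; intros; apply hS; assumption).
    assert (ep : proj (S_ N) (S N) (F N b) = proj b (S N) (F N b)).
    { apply comb_ext; intros j hj; rewrite hS by lia; reflexivity. }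
    rewrite eF, ep in h. symmetry. exact h.
Qed.

(** [S i], because row 0 of the queue holds the dense sequence; the outer successors count the
    [N + 2] vectors present after step [N]. *)
Definition reach (i m : nat) : nat := S (S (Cantor.to_nat (S i, m))).

(* Gram-Schmidt on a queue of vectors: a dense sequence, interleaved with all the [T i (b m)].  The
   point is that [reach] depends neither on [T] nor on [v0]. *)
Lemma exists_adapted_basis (Hsep : @separable H) (Hinf : @infinite_dimensional H)
  (T : nat -> H -> H) v0 : <<v0, v0>> = C1 ->
  exists b, orthonormal b /\ total b /\ b 0%nat = v0 /\
    forall i m, proj b (reach i m) (T i (b m)) = T i (b m).
Proof.
  intros hv0. destruct Hsep as [e he].
  pose (G := fun i m w => match i with 0%nat => e m | S i => T i w end).
  destruct (exists_adapted_sequence Hinf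
    (fun N s => let p := Cantor.of_nat N in G (fst p) (snd p) (s (snd p))) v0 hv0) as [b [hb [b0 hp]]].
  (* The Cantor code of [(i, m)] is at least [m], so [T i (b m)] is queued no earlier than [b m]
     exists. *)
  - intros N s s' h. cbv zeta. f_equal. apply h.
    rewrite <- (Cantor.cancel_to_of N) at 2. destruct (Cantor.of_nat N) as [i m].
    pose proof (Cantor.to_nat_non_decreasing i m). simpl fst; simpl snd. lia.
  - assert (hG : forall i m, proj b (S (S (Cantor.to_nat (i, m)))) (G i m (b m)) = G i m (b m)).
    { intros i m. specialize (hp (Cantor.to_nat (i, m))). cbv zeta in hp.
      rewrite Cantor.cancel_of_to in hp. exact hp. }
    exists b. split; [exact hb|]. split; [|split; [exact b0|]].
    + intros v eps h0. destruct (he v eps h0) as [m hm].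
      exists (S (S (Cantor.to_nat (0%nat, m)))).
      eapply Rle_lt_trans; [|exact hm]. eapply proj_best; [apply hb | apply Nat.le_refl | apply (hG 0%nat m)].
    + intros i m. apply (hG (S i) m).
Qed.

Lemma total_proj_limit b v : orthonormal b -> total b ->
  forall eps, 0 < eps -> exists N, forall n, (N <= n)%nat -> hnorm (proj b n v -' v) < eps.
Proof.
  intros hb ht eps h0. destruct (ht v eps h0) as [N hN]. exists N. intros n hn.
  rewrite hnorm_sub_sym. eapply Rle_lt_trans; [|exact hN].
  apply (proj_best b N n); [apply hb | exact hn | apply proj_comb; [apply hb | lia]].
Qed.

Lemma total_ext b v w : orthonormal b -> total b -> (forall j, <<v, b j>> = <<w, b j>>) -> v = w.
Proof.
  intros hb ht h. apply (limit_unique (fun n => proj b n v)).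
  - apply total_proj_limit; assumption.
  - intros eps h0. destruct (total_proj_limit b w hb ht eps h0) as [N hN]. exists N. intros n hn.
    replace (proj b n v) with (proj b n w); [apply hN, hn|].
    apply comb_ext; intros; rewrite ?h; reflexivity.
Qed.

(** Both sides equal the sum of the squared moduli of [c j] for [M <= j < N]. Comparing two bases
    transfers the Cauchy property without any series. *)
Lemma comb_dist b e c M N : orthonormal b -> orthonormal e -> (M <= N)%nat ->
  hnorm (comb c b N -' comb c b M) ^ 2 = hnorm (comb c e N -' comb c e M) ^ 2.
Proof.
  intros hb he h. induction h as [|N h IH]; [rewrite !hnorm_sub_self; reflexivity|].
  assert (q : forall s, orthonormal s -> hnorm (comb c s (S N) -' comb c s M) ^ 2 =
    hnorm (comb c s N -' comb c s M) ^ 2 + Cmod (c N) ^ 2).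
  { intros s hs. simpl comb.
    replace (_ -' _) with ((comb c s N -' comb c s M) +' c N *' s N) by vring.
    assert (o : forall K, (K <= N)%nat -> <<comb c s K, s N>> = C0).
    { intros K hK. apply comb_inner_orth. intros j hj. rewrite (hs (S N)) by lia.
      destruct (Nat.eqb_spec j N); [lia | reflexivity]. }
    rewrite hnorm_sqr, !ip_add_l, !ip_add_r, (ip_sym (c N *' s N) (comb c s N -' _)).
    replace (ip (comb c s N -' comb c s M) (c N *' s N)) with 0.
    - rewrite <- !hnorm_sqr, hnorm_scal, orthonormal_norm by exact hs. ring.
    - unfold ip. rewrite inner_scal_r, inner_sub_l, !o by lia. simpl. ring. }
  rewrite !q, IH by assumption. reflexivity.
Qed.

(** [V v] is the sum of the coefficients of [v] in [e] times the [b j]. The coefficient identity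
    makes the two such maps mutually inverse once [b] is total too. *)
Lemma basis_isometry e b : orthonormal e -> total e -> orthonormal b ->
  exists V : H -> H, is_linear V /\ (forall v, hnorm (V v) = hnorm v) /\
    (forall j, V (e j) = b j) /\ forall v j, <<V v, b j>> = <<v, e j>>.
Proof.
  intros he te hb.
  pose (c := fun v j => <<v, e j>>).
  assert (ex : forall v, exists l, forall eps, 0 < eps -> exists N, forall n, (N <= n)%nat ->
    hnorm (comb (c v) b n -' l) < eps).
  { intros v. destruct (hs_complete H (comb (c v) b)) as [l hl]; [|exists l; exact hl].
    intros eps h0. destruct (total_proj_limit e v he te (eps / 2)) as [N hN]; [lra|].
    exists N. intros m n hm hn. change (hnorm (comb (c v) b m -' comb (c v) b n) < eps).
    replace (hnorm (comb (c v) b m -' comb (c v) b n)) with (hnorm (proj e m v -' proj e n v)).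
    - pose proof (hN m hm). pose proof (hN n hn) as q. rewrite hnorm_sub_sym in q.
      pose proof (hnorm_sub_triangle (proj e m v) v (proj e n v)). lra.
    - apply sqr_eq_eq; try apply hnorm_nonneg. destruct (Nat.le_ge_cases m n) as [g|g].
      + rewrite (hnorm_sub_sym (proj e m v)), (hnorm_sub_sym (comb (c v) b m)).
        symmetry; apply comb_dist; assumption.
      + symmetry; apply comb_dist; assumption. }
  apply choice_fun in ex. destruct ex as [V hV]. exists V.
  assert (inner : forall v j, <<V v, b j>> = <<v, e j>>).
  { intros v j.
    assert (q : forall eps, 0 < eps -> Cmod (Csub <<v, e j>> <<V v, b j>>) <= 2 * eps).
    { intros eps h0. destruct (hV v eps h0) as [N hN].
      specialize (hN (N + S j)%nat ltac:(lia)).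
      assert (q : Csub <<v, e j>> <<V v, b j>> = <<comb (c v) b (N + S j) -' V v, b j>>).
      { rewrite inner_sub_l, comb_inner; [reflexivity | apply hb | lia]. }
      rewrite q. pose proof (inner_re_abs (comb (c v) b (N + S j) -' V v) (b j)) as r1.
      pose proof (inner_im_abs (comb (c v) b (N + S j) -' V v) (b j)) as r2.
      rewrite (orthonormal_norm b j hb), Rmult_1_r in r1, r2. apply Cmod_le; lra. }
    assert (z : Cmod (Csub <<v, e j>> <<V v, b j>>) = 0).
    { apply Rle_antisym; [|apply Cmod_nonneg]. apply le_epsilon. intros eps h0.
      specialize (q (eps / 2)). lra. }
    apply Cmod_eq0 in z. replace <<V v, b j>> with (Csub <<v, e j>> (Csub <<v, e j>> <<V v, b j>>)) by ring.
    rewrite z. ring. }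
  split; [split|split; [|split; [|exact inner]]].
  - intros u v. apply (limit_unique (comb (c (u +' v)) b)); [apply hV|]. intros eps h0.
    destruct (hV u (eps / 2)) as [N hN]; [lra|]. destruct (hV v (eps / 2)) as [N' hN']; [lra|].
    exists (N + N')%nat. intros n hn. specialize (hN n ltac:(lia)). specialize (hN' n ltac:(lia)).
    assert (q : comb (c (u +' v)) b n = comb (c u) b n +' comb (c v) b n).
    { clear. unfold c. induction n as [|n IH]; simpl; [vring|]. rewrite IH, hs_inner_addl. vring. }
    rewrite q. replace (_ -' _) with ((comb (c u) b n -' V u) +' (comb (c v) b n -' V v)) by vring.
    eapply Rle_lt_trans; [apply hnorm_add | lra].
  - intros a v. apply (limit_unique (comb (c (a *' v)) b)); [apply hV|]. intros eps h0.
    pose proof (Cmod_nonneg a).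
    destruct (hV v (eps / (Cmod a + 1))) as [N hN]; [apply Rdiv_lt_0_compat; lra|].
    exists N. intros n hn. specialize (hN n hn).
    assert (q : comb (c (a *' v)) b n = a *' comb (c v) b n).
    { clear. unfold c. induction n as [|n IH]; simpl; [vring|]. rewrite IH, hs_inner_scall. vring. }
    rewrite q. replace (_ -' _) with (a *' (comb (c v) b n -' V v)) by vring.
    rewrite hnorm_scal. pose proof (hnorm_nonneg (comb (c v) b n -' V v)).
    apply (Rmult_lt_compat_l (Cmod a + 1)) in hN; [|lra].
    replace ((Cmod a + 1) * (eps / (Cmod a + 1))) with eps in hN by (field; lra). nra.
  - intros v.
    assert (q : forall n, hnorm (comb (c v) b n) = hnorm (proj e n v)).
    { intros n. apply sqr_eq_eq; try apply hnorm_nonneg.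
      pose proof (comb_dist b e (c v) 0 n hb he ltac:(lia)) as q. simpl comb in q.
      rewrite !hnorm_sub_zero in q. exact q. }
    assert (b1 : forall eps, 0 < eps -> Rabs (hnorm (V v) - hnorm v) <= eps).
    { intros eps h0. destruct (hV v (eps / 2)) as [N hN]; [lra|].
      destruct (total_proj_limit e v he te (eps / 2)) as [N' hN']; [lra|].
      specialize (hN (N + N')%nat ltac:(lia)). specialize (hN' (N + N')%nat ltac:(lia)).
      specialize (q (N + N')%nat).
      set (s := comb (c v) b (N + N')) in *. set (p := proj e (N + N') v) in *.
      pose proof (hnorm_add (s -' V v) (V v)) as t1. replace (_ +' V v) with s in t1 by vring.
      pose proof (hnorm_sub s (s -' V v)) as t2. replace (s -' (s -' V v)) with (V v) in t2 by vring.
      pose proof (hnorm_add (p -' v) v) as t3. replace (_ +' v) with p in t3 by vring.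
      pose proof (hnorm_sub p (p -' v)) as t4. replace (p -' (p -' v)) with v in t4 by vring.
      apply Rabs_le. lra. }
    assert (z : Rabs (hnorm (V v) - hnorm v) <= 0).
    { apply le_epsilon. intros eps h0. specialize (b1 eps h0). lra. }
    apply Rabs_le_inv in z. lra.
  - intros j. apply (limit_unique (comb (c (e j)) b)); [apply hV|]. intros eps h0.
    exists (S j). intros n hn. replace (comb (c (e j)) b n) with (b j).
    + rewrite hnorm_sub_self. exact h0.
    + rewrite <- (proj_basis b n j) at 1; [|apply hb | lia].
      apply comb_ext; [|reflexivity]. intros i hi. unfold c.
      rewrite (hb (S (i + j))), (he (S (i + j))) by lia. reflexivity.
Qed.

Lemma basis_unitary e b : orthonormal e -> total e -> orthonormal b -> total b ->
  exists V V' : H -> H, is_linear V /\ is_linear V' /\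
    (forall v, hnorm (V v) = hnorm v) /\ (forall v, hnorm (V' v) = hnorm v) /\
    (forall v, V (V' v) = v) /\ (forall v, V' (V v) = v) /\
    (forall j, V (e j) = b j) /\ (forall j, V' (b j) = e j).
Proof.
  intros he te hb tb.
  destruct (basis_isometry e b he te hb) as [V [l1 [n1 [e1 i1]]]].
  destruct (basis_isometry b e hb tb he) as [V' [l2 [n2 [e2 i2]]]].
  exists V, V'. repeat (split; [assumption|]). split; [|split; [|split; assumption]].
  - intros v. apply (total_ext b); auto. intros j. rewrite i1, i2. reflexivity.
  - intros v. apply (total_ext e); auto. intros j. rewrite i2, i1. reflexivity.
Qed.

End Bases.

(** * Strong limits up to unitary equivalence *)

Lemma unitary_conj_linear {H : HilbertSpace} (V V' T : H -> H) :
  is_linear V -> is_linear V' -> is_linear T -> is_linear (fun w => V' (T (V w))).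
Proof.
  intros h1 h2 h3. split; intros.
  - rewrite (lin_add V), (lin_add T), (lin_add V'); auto.
  - rewrite (lin_scal V), (lin_scal T), (lin_scal V'); auto.
Qed.

(* Strong compactness up to unitary equivalence: in a basis adapted to [T a n] and [v n], the columns of
   the matrix of [T a n] have finite supports that do not depend on [n], so they converge in norm. *)
Lemma unitary_strong_limit {H : HilbertSpace} (Hsep : @separable H) (Hinf : @infinite_dimensional H)
  (U : (nat -> Prop) -> Prop) (hU : ultra U) {A : Type} (enc : A -> nat)
  (henc : forall a a', enc a = enc a' -> a = a') (T : A -> nat -> H -> H) (B : A -> R)
  (v : nat -> H) :
  (forall a, 0 <= B a) -> (forall a n, is_linear (T a n)) -> (forall a n, bounded_by (T a n) (B a)) ->
  (forall n, hnorm (v n) = 1) ->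
  exists (V V' : nat -> H -> H) (v0 : H) (T' : A -> H -> H),
    (forall n, is_linear (V n)) /\ (forall n, is_linear (V' n)) /\
    (forall n w, hnorm (V n w) = hnorm w) /\ (forall n w, hnorm (V' n w) = hnorm w) /\
    (forall n w, V n (V' n w) = w) /\ (forall n w, V' n (V n w) = w) /\
    (forall n, V n v0 = v n) /\
    (forall a, is_linear (T' a)) /\ (forall a, bounded_by (T' a) (B a)) /\
    forall a w, vlim U (fun n => V' n (T a n (V n w))) (T' a w).
Proof.
  intros B0 hl hB hv.
  (* The basis construction wants families indexed by [nat]; codes that come from no [a] receive the
     identity. *)
  assert (dec : exists D : nat -> nat -> H -> H, forall n a, D n (enc a) = T a n).
  { assert (ex : forall p : nat * nat, exists D : H -> H, forall a, enc a = snd p -> D = T a (fst p)).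
    { intros [n j]. simpl. destruct (classic (exists a, enc a = j)) as [[a <-]|c].
      - exists (T a n). intros a' e. apply henc in e. subst; reflexivity.
      - exists (fun w => w). intros a e. exfalso. apply c. exists a; exact e. }
    apply choice_fun in ex. destruct ex as [D hD]. exists (fun n j => D (n, j)).
    intros n a. apply (hD (n, enc a)). reflexivity. }
  destruct dec as [D hD].
  assert (hv1 : forall n, <<v n, v n>> = C1).
  { intros n. apply Cx_ext; [|apply inner_self_im].
    pose proof (hnorm_sqr (v n)) as q. rewrite hv in q. unfold ip in q. rewrite <- q. simpl. ring. }
  pose proof (fun n => exists_adapted_basis Hsep Hinf (D n) (v n) (hv1 n)) as ex.
  apply choice_fun in ex. destruct ex as [b hb].
  assert (ob : forall n, orthonormal (b n)) by (intros; apply hb).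
  assert (tb : forall n, total (b n)) by (intros; apply hb).
  (* A common reference basis; [V n] carries it to [b n], so [e 0] goes to [v n]. *)
  set (e := b 0%nat).
  assert (ex : forall n, exists VV : (H -> H) * (H -> H), is_linear (fst VV) /\ is_linear (snd VV) /\
    (forall w, hnorm (fst VV w) = hnorm w) /\ (forall w, hnorm (snd VV w) = hnorm w) /\
    (forall w, fst VV (snd VV w) = w) /\ (forall w, snd VV (fst VV w) = w) /\
    (forall j, fst VV (e j) = b n j) /\ (forall j, snd VV (b n j) = e j)).
  { intros n. destruct (basis_unitary e (b n) (ob 0%nat) (tb 0%nat) (ob n) (tb n)) as [V [V' h]].
    exists (V, V'). exact h. }
  apply choice_fun in ex. destruct ex as [VV hVV].
  pose (V := fun n => fst (VV n)). pose (V' := fun n => snd (VV n)).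
  assert (lV : forall n, is_linear (V n)) by (intros; apply hVV).
  assert (lV' : forall n, is_linear (V' n)) by (intros; apply hVV).
  assert (nV : forall n w, hnorm (V n w) = hnorm w) by (intros; apply hVV).
  assert (nV' : forall n w, hnorm (V' n w) = hnorm w) by (intros; apply hVV).
  assert (eV : forall n j, V n (e j) = b n j) by (intros; apply hVV).
  assert (eV' : forall n j, V' n (b n j) = e j) by (intros; apply hVV).
  pose (Tn := fun a n w => V' n (T a n (V n w))).
  assert (lT : forall a n, is_linear (Tn a n)) by (intros; apply unitary_conj_linear; auto).
  assert (bT : forall a n, bounded_by (Tn a n) (B a)).
  { intros a n w. unfold Tn. rewrite nV', <- (nV n w). apply hB. }
  assert (col : forall a m, exists l, vlim U (fun n => Tn a n (e m)) l).
  { intros a m.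
    pose (c := fun n j => <<T a n (b n m), b n j>>).
    assert (q : (fun n => Tn a n (e m)) = fun n => comb (c n) e (reach (enc a) m)).
    { extensionality n. unfold Tn. rewrite eV.
      destruct (hb n) as [_ [_ [_ hr]]]. specialize (hr (enc a) m). rewrite hD in hr.
      rewrite <- hr. unfold proj. rewrite comb_map by apply lV'.
      apply comb_ext; intros; [reflexivity | apply eV']. }
    assert (hc : forall n j, hnorm (T a n (b n m)) * hnorm (b n j) <= B a).
    { intros n j. rewrite (orthonormal_norm (b n) j (ob n)), Rmult_1_r.
      pose proof (hB a n (b n m)) as h. rewrite (orthonormal_norm (b n) m (ob n)), Rmult_1_r in h. exact h. }
    rewrite q. generalize (reach (enc a) m). intros N. induction N as [|N [l IH]].
    - exists 0'. exact (vlim_const U hU 0').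
    - destruct (vlim_scal_exists U hU (fun n => c n N) (e N) (B a) (B0 a)) as [l' h'].
      + intros n. eapply Rle_trans; [apply inner_re_abs | apply hc].
      + intros n. eapply Rle_trans; [apply inner_im_abs | apply hc].
      + exists (l +' l'). simpl. apply vlim_add; assumption. }
  assert (lim : forall a, exists T', is_linear T' /\ bounded_by T' (B a) /\
    forall w, vlim U (fun n => Tn a n w) (T' w)).
  { intros a. apply operator_limit; auto. intros w eps h0.
    destruct (tb 0%nat w eps h0) as [N hN]. exists (proj e N w). split; [exact hN|].
    unfold proj. generalize (fun j => <<w, e j>>). intros c. clear hN. induction N as [|N [l IH]].
    - exists 0'. simpl. replace (fun n => Tn a n 0') with (fun _ : nat => (0' : H))
        by (extensionality n; symmetry; apply lin_zero, lT). exact (vlim_const U hU 0').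
    - destruct (col a N) as [l' h']. exists (l +' c N *' l'). simpl.
      replace (fun n => Tn a n (comb c e N +' c N *' e N)) with
        (fun n => Tn a n (comb c e N) +' c N *' Tn a n (e N))
        by (extensionality n; rewrite (lin_add _ _ _ (lT a n)), (lin_scal _ _ _ (lT a n)); reflexivity).
      apply vlim_add; [exact hU | exact IH |].
      apply (vlim_BH U hU (fun u => c N *' u)); [apply BH_scal, BH_id | exact h']. }
  apply choice_fun in lim. destruct lim as [T' hT'].
  exists V, V', (e 0%nat), T'.
  repeat (split; [assumption|]).
  split; [intros; apply hVV|]. split; [intros; apply hVV|].
  split; [intros n; rewrite eV; apply hb|].
  split; [intros; apply hT'|]. split; [intros; apply hT'|]. intros; apply hT'.
Qed.

Lemma vlim_block {H : HilbertSpace} {d : nat} (U : (nat -> Prop) -> Prop) (hU : ultra U)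
  (hv : halves H) a (x h : nat -> @tuple H d) X K :
  (forall i v, vlim U (fun n => x n i v) (X i v)) -> (forall i v, vlim U (fun n => h n i v) (K i v)) ->
  forall i v, vlim U (fun n => block hv (x n) (x n) (tscal a (h n)) i v)
    (block hv X X (tscal a K) i v).
Proof.
  intros hx hh i v. unfold block, tscal. apply vlim_add; [exact hU | |].
  - apply (vlim_BH U hU (hJ1 hv)); [apply BH_J1|]. apply vlim_add; [exact hU | apply hx |].
    apply (vlim_BH U hU (fun w => a *' w)); [apply BH_scal, BH_id | apply hh].
  - apply (vlim_BH U hU (hJ2 hv)); [apply BH_J2 | apply hx].
Qed.

(** * A point where the derivative has a kernel *)

Section Degenerate.
Context {H : HilbertSpace} (Hsep : @separable H) (Hinf : @infinite_dimensional H)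
  {d r : nat} (hv : halves H)
  (Om : @tuple H d -> Prop) (Ok : nat -> @tuple H d -> Prop)
  (Hex : nc_exhaustion Om Ok) (HOm : forall x, Om x -> is_BHd x)
  (f : @tuple H d -> @tuple H r) (Hf : forall x, Om x -> is_BHd (f x))
  (Hnc : nc_function Om f)
  (Hclosed : forall k, sot_closed (Ok k)) (Hcont : forall k, sot_continuous_on (Ok k) f).

Lemma degenerate_limit k e x (he : radius Ok k e) (hx : Ok k x)
  (h : nat -> @tuple H d) (ind : nat -> Fin.t d) (v : nat -> H) :
  (forall n, is_BHd (h n)) -> (forall n, tnorm (h n) <= 1) -> (forall n, hnorm (v n) = 1) ->
  (forall n, 1 / 2 <= hnorm (h n (ind n) (v n))) ->
  (forall n, tuple_bounded_by (deriv hv f e x (h n)) (/ (INR n + 1))) ->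
  exists X K, Ok k X /\ is_BHd K /\ K <> tzero /\ deriv hv f e X K = tzero.
Proof.
  intros bh nh nv lower small.
  destruct exists_ultra as [U hU].
  assert (bx : is_BHd x) by (eapply Ok_BHd; eassumption).
  (* The coordinates of [x] and of [h n] must converge in one and the same basis, so they form a
     single family, with even and odd codes. *)
  pose (enc := fun a : Fin.t d + Fin.t d => match a with
    | inl i => (2 * proj1_sig (Fin.to_nat i))%nat
    | inr i => (2 * proj1_sig (Fin.to_nat i) + 1)%nat end).
  destruct (unitary_strong_limit Hsep Hinf U hU enc) with
    (T := fun a n => match a with inl i => x i | inr i => h n i end)
    (B := fun a : Fin.t d + Fin.t d => match a with inl i => tnorm x | inr i => 1 end) (v := v)
    as [V [V' [v0 [T' [lV [lV' [nV [nV' [VV' [V'V [eV [lT [bT hT]]]]]]]]]]]]].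
  { intros [i|i] [j|j] q; unfold enc in q; try lia; f_equal; apply Fin.to_nat_inj; lia. }
  { intros [i|i]; [apply tnorm_nonneg, bx | lra]. }
  { intros [i|i] n; apply BHd_lin; auto. }
  { intros [i|i] n; [apply tnorm_bound, bx | apply tuple_bounded_by_tnorm; auto]. }
  { exact nv. }
  pose (X := fun i => T' (inl i)). pose (K := fun i => T' (inr i)).
  pose (xn := fun n (i : Fin.t d) w => V' n (x i (V n w))).
  pose (hn := fun n (i : Fin.t d) w => V' n (h n i (V n w))).
  assert (limX : forall i w, vlim U (fun n => xn n i w) (X i w)) by (intros; apply (hT (inl i))).
  assert (limK : forall i w, vlim U (fun n => hn n i w) (K i w)) by (intros; apply (hT (inr i))).
  assert (bV : forall n, is_BH (V n)).
  { intros n. split; [apply lV|]. exists 1. intros w. rewrite nV. lra. }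
  assert (bV' : forall n, is_BH (V' n)).
  { intros n. split; [apply lV'|]. exists 1. intros w. rewrite nV'. lra. }
  assert (bX : is_BHd X).
  { intros i. split; [apply lT|]. exists (tnorm x). apply (bT (inl i)). }
  assert (bK : is_BHd K).
  { intros i. split; [apply lT|]. exists 1. apply (bT (inr i)). }
  assert (nK : tnorm K <= 1) by (apply tnorm_le; [lra | intros i; apply (bT (inr i))]).
  assert (bhn : forall n, is_BHd (hn n)).
  { intros n i. apply (BH_comp (V' n) (fun w => h n i (V n w))); [apply bV'|].
    apply BH_comp; [apply bh | apply bV]. }
  assert (nhn : forall n, tnorm (hn n) <= 1).
  { intros n. apply tnorm_le; [lra|]. intros i w. unfold hn. rewrite nV', <- (nV n w).
    apply tuple_bounded_by_tnorm; auto. }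
  assert (kxn : forall n, Ok k (xn n)).
  { intros n. destruct Hex as [_ [_ [_ [hinv _]]]]. apply (hinv k x (V n)); [exact hx | |].
    - split; [apply lV|]. split; [|apply nV]. intros w. exists (V' n w). apply VV'.
    - intros i w. apply VV'. }
  assert (kX : Ok k X).
  { apply (sot_closed_limit U hU (Ok k) xn); auto. intros n. eapply Ok_BHd; eauto. }
  (* With [c = e / 2] every direction of norm at most 1 gives a corner of norm below [e], so all the
     block tuples, the limit included, lie in [Ok (S k)], where [f] is strongly continuous. *)
  pose proof (proj1 he) as e0. set (c := e / 2).
  assert (sm : forall g : @tuple H d, is_BHd g -> tnorm g <= 1 -> tnorm (tscal (RC c) g) < e).
  { intros g bg ng. eapply Rle_lt_trans; [apply tnorm_RC_le; [unfold c; lra | exact bg]|].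
    unfold c. nra. }
  assert (okb : forall y g, Ok k y -> is_BHd g -> tnorm g <= 1 ->
    Ok (S k) (block hv y y (tscal (RC c) g))).
  { intros y g ky bg ng. eapply Ok_block; eauto using BHd_tscal. }
  assert (lim : forall i w, vlim U (fun n => delta hv f (xn n) (xn n) (tscal (RC c) (hn n)) i w)
    (delta hv f X X (tscal (RC c) K) i w)).
  { intros i w. unfold delta. apply (vlim_BH U hU (hP1 hv)); [apply BH_P1|].
    apply (sot_continuous_limit U hU (Ok (S k)) f
      (fun n => block hv (xn n) (xn n) (tscal (RC c) (hn n)))); auto.
    apply vlim_block; assumption. }
  (* Conjugation by [V n] turns this corner into [c] times the derivative at [x] along [h n], which
     is at most [c / (n + 1)]. *)
  assert (zero : forall i w, vlim U (fun n => delta hv f (xn n) (xn n) (tscal (RC c) (hn n)) i w) 0').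
  { intros i w. apply (vlim_squeeze U hU _ (fun n => c * (/ (INR n + 1) * hnorm w))).
    - intros n. rewrite <- nV with (n := n).
      rewrite <- (delta_conj hv Om Ok Hex HOm f Hf Hnc x x (tscal (RC c) (h n)));
        auto using BHd_tscal.
      + rewrite (deriv_spec hv Om Ok Hex HOm f Hf Hnc k e x he hx) by auto.
        unfold tscal. rewrite hnorm_RC, Rabs_right by (unfold c; lra).
        apply Rmult_le_compat_l; [unfold c; lra|]. rewrite <- (nV n w). apply small.
      + eapply Ok_Om; eauto.
      + eapply Ok_Om; eauto.
      + intros; symmetry; apply VV'.
      + intros; symmetry; apply VV'.
      + intros j u. unfold tscal, hn. rewrite (lin_scal (V n)), VV' by apply lV. reflexivity.
    - intros eps h0. pose proof (hnorm_nonneg w).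
      assert (c0 : 0 < c) by (unfold c; lra).
      assert (p : 0 < c * (hnorm w + 1)) by nra.
      destruct (inv_INR_small (eps / (c * (hnorm w + 1)))) as [N hN];
        [apply Rdiv_lt_0_compat; lra|].
      apply (ultra_mono U hU) with (2 := ultra_tail U hU N). intros n hn'. specialize (hN n hn').
      assert (0 < / (INR n + 1)) by (apply Rinv_0_lt_compat; pose proof (pos_INR n); lra).
      apply (Rmult_lt_compat_r _ _ _ p) in hN.
      replace (eps / (c * (hnorm w + 1)) * (c * (hnorm w + 1))) with eps in hN by (field; lra).
      nra. }
  exists X, K. split; [exact kX|]. split; [exact bK|]. split.
  - intros z.
    (* The coordinate [ind n] varies with [n], so smallness at [v0] is needed in all coordinates for
       one [n]; there [V n v0 = v n] contradicts [lower]. *)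
    assert (q : U (fun n => forall i, hnorm (hn n i v0) < 1 / 2)).
    { apply (ultra_Fin U hU). intros i. apply (ultra_mono U hU) with (2 := limK i v0 (1 / 2) ltac:(lra)).
      intros n. rewrite z. unfold tzero. rewrite hnorm_sub_zero. auto. }
    destruct (ultra_ex U hU _ q) as [n hq]. specialize (hq (ind n)). unfold hn in hq.
    rewrite nV', eV in hq. specialize (lower n). lra.
  - assert (q : delta hv f X X (tscal (RC c) K) = tzero).
    { apply tuple_ext. intros i w. apply (vlim_unique U hU) with (1 := lim i w) (2 := zero i w). }
    rewrite (deriv_spec hv Om Ok Hex HOm f Hf Hnc k e X he kX) in q by auto.
    apply (tscal_RC_inj c); [unfold c; lra|]. rewrite q.
    apply tuple_ext. intros. symmetry. apply hs_scal_zero_r.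
Qed.

End Degenerate.

Theorem theorem2p4 (H : HilbertSpace)
  (Hsep : @separable H) (Hinf : @infinite_dimensional H)
  (d r : nat) (Om : @tuple H d -> Prop) (f : @tuple H d -> @tuple H r)
  (HOm : forall x, Om x -> is_BHd x)
  (Hf : forall x, Om x -> is_BHd (f x))
  (Hstrong : strong_nc_function Om f)
  (Hinj : forall x, Om x -> forall L, frechet_deriv Om f x L -> injective_on_BH L) :
  forall x, Om x -> forall L, frechet_deriv Om f x L -> bounded_below L.
Proof.
  intros x ox L hL.
  destruct Hstrong as [Hnc [Ok [[Hex [Hclosed Hrad]] Hcont]]].
  change (forall k, exists e, radius Ok k e) in Hrad.
  destruct (proj1 (proj1 (proj2 Hex) x) ox) as [k hx].
  assert (hh : exists hv : halves H, True).
  { destruct Hex as [_ [_ [_ [_ hsum]]]].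
    destruct (hsum k (Some 2%nat) (fun _ => x)) as [u [hu _]]; [simpl; lia | auto |].
    destruct (exists_halves u hu) as [hv _]. exists hv; exact I. }
  destruct hh as [hv _].
  assert (hrad : exists e, radius Ok k e /\ radius Ok (S k) e).
  { destruct (Hrad k) as [e1 h1], (Hrad (S k)) as [e2 h2].
    assert (0 < Rmin e1 e2) by (apply Rmin_glb_lt; [apply h1 | apply h2]).
    exists (Rmin e1 e2). split; [apply (radius_le Ok k e1) | apply (radius_le Ok (S k) e2)];
      auto using Rmin_l, Rmin_r. }
  destruct hrad as [e [he he']].
  apply NNPP. intros nb.
  assert (ex : forall n : nat, exists p : @tuple H d * Fin.t d * H,
    let '(g, i, v) := p in is_BHd g /\ tnorm g <= 1 /\ hnorm v = 1 /\ 1 / 2 <= hnorm (g i v) /\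
    tuple_bounded_by (deriv hv f e x g) (/ (INR n + 1))).
  { intros n. assert (n0 : 0 < / (INR n + 1)) by (apply Rinv_0_lt_compat; pose proof (pos_INR n); lra).
    assert (ex : exists h, is_BHd h /\ tnorm (L h) < / (INR n + 1) * tnorm h).
    { apply NNPP. intros c. apply nb. exists (/ (INR n + 1)). split; [exact n0|].
      intros h bh. apply Rnot_lt_le. intros lt. apply c. exists h; auto. }
    destruct ex as [h [bh hlt]].
    pose proof hL as [Lb [_ [Ls _]]].
    pose proof (tnorm_nonneg _ (Lb h bh)) as p0. pose proof (tnorm_nonneg h bh).
    assert (p : 0 < tnorm h) by nra.
    (* The norm need not be attained; half of it is, on a unit vector, which is the origin of
       [1 / 2]. *)
    destruct (tnorm_large h (tnorm h / 2)) as [i [v [nv hv']]]; [lra | lra | exact bh |].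
    assert (ip : 0 < / tnorm h) by (apply Rinv_0_lt_compat, p).
    exists (tscal (RC (/ tnorm h)) h, i, v). split; [apply BHd_tscal, bh|]. split; [|split; [exact nv|split]].
    - eapply Rle_trans; [apply tnorm_RC_le; assumption|]. rewrite Rinv_l; lra.
    - unfold tscal. rewrite hnorm_RC, Rabs_right by lra.
      apply (Rmult_le_reg_l (tnorm h)); [exact p|]. rewrite <- Rmult_assoc, Rinv_r by lra. lra.
    - rewrite <- (frechet_deriv_eq hv Om Ok Hex HOm f Hf Hnc Hrad k e x he hx he' L)
        by auto using BHd_tscal.
      rewrite Ls by exact bh. intros j w. unfold tscal. rewrite hnorm_RC, Rabs_right by lra.
      pose proof (tnorm_bound _ (Lb h bh) j w) as q. pose proof (hnorm_nonneg w).
      apply (Rmult_le_reg_l (tnorm h)); [exact p|].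
      rewrite <- Rmult_assoc, Rinv_r, Rmult_1_l by lra.
      eapply Rle_trans; [exact q|]. rewrite <- Rmult_assoc.
      apply Rmult_le_compat_r; [assumption | lra]. }
  apply choice_fun in ex. destruct ex as [p hp].
  destruct (degenerate_limit Hsep Hinf hv Om Ok Hex HOm f Hf Hnc Hclosed Hcont k e x he hx
    (fun n => fst (fst (p n))) (fun n => snd (fst (p n))) (fun n => snd (p n)))
    as [X [K [kX [bK [nK hK]]]]];
    try (intros n; specialize (hp n); destruct (p n) as [[g i] v]; simpl; tauto).
  (* [Hinj] at [X] requires a Fréchet derivative there. [X] lies in the same [Ok k] as [x], so the
     same [e] serves. *)
  apply nK. apply (Hinj X (Ok_Om Om Ok Hex k X kX) (deriv hv f e X)); [|exact bK | exact hK].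
  exact (frechet_deriv_deriv hv Om Ok Hex HOm f Hf Hnc Hrad k e X he kX he').
Qed.
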